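(* Let $m\ge 0$ be an integer and let $f(x)=\prod_{i=1}^k(x-a_i)^{b_i}$ with $a_1,\dots,a_k,b_1,\dots,b_k\in\mathbb C$ and $a_1,\dots,a_k$ pairwise distinct. Then the Hilbert series of the space $Q_m(f)\subset\mathbb C[x,y]$ of twisted quasi-invariants is \[\frac{t^{2m}+t^{2m+1}+\sum_{i=1}^m t^{2(m-i)+d_i(f)}-\sum_{i=1}^m t^{2(m-i)+d_i(f)+2}}{(1-t)(1-t^2)}.\]
   Context: For an integer $m\ge0$ and $z\in\mathbb C$, put $d_m(z)=\min(m,|z|)$ if $z\in\mathbb Z$ and $d_m(z)=m$ otherwise; for $f(x)=\prod_{i=1}^k(x-a_i)^{b_i}$ with $a_1,\dots,a_k$ pairwise distinct, put $d_m(f)=\sum_{i=1}^k d_m(b_i)$. Twisted quasi-invariants: choose a nonempty connected open set $U\subset\mathbb C\setminus\{a_1,\dots,a_k\}$ on which a single-valued holomorphic branch of $f$ exists, and fix such a branch. Then $Q_m(f)$ is the space of polynomials $F\in\mathbb C[x,y]$ such that \[\frac{f(x)F(x,y)-f(y)F(y,x)}{(x-y)^{2m+1}}\] extends to a smooth (equivalently, holomorphic) function on $D=U\times U$. This does not depend on the choice of $U$ and of the branch. Hilbert series: let $Q_m(f)_{\le d}$ be the space of elements of $Q_m(f)$ of total degree at most $d$ (with $Q_m(f)_{\le -1}=0$). The Hilbert series of $Q_m(f)$ is $\sum_{d\ge0}\bigl(\dim_{\mathbb C} Q_m(f)_{\le d}-\dim_{\mathbb C} Q_m(f)_{\le d-1}\bigr)t^d$;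 this is the usual graded Hilbert series when $Q_m(f)$ is spanned by homogeneous polynomials. *)

(* Defs.v *)
From HB Require Import structures.
From mathcomp Require Import all_boot all_order all_algebra.
From mathcomp Require Import all_classical all_reals all_analysis.
From mathcomp Require Import complex.

Set Implicit Arguments.
Unset Strict Implicit.
Unset Printing Implicit Defensive.

Import Order.TTheory GRing.Theory Num.Theory.
Import numFieldNormedType.Exports.

Local Open Scope classical_set_scope.
Local Open Scope ring_scope.

(* R[i] packaged as a [numClosedFieldType], so that the normed-module structure
   of a numeric field over itself applies: [derivable _ z 1] and
   [differentiable _ p] below are complex differentiability. *)
Definition CC (R : realType) : numClosedFieldType := R[i].

Section TwistedQuasiInvariants.
Variable R : realType.
Local Notation C := (CC R).

Definition cexp (z : C) : C :=
  Complex (expR (complex.Re z) * cos (complex.Im z))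
          (expR (complex.Re z) * sin (complex.Im z)).

Definition holomorphic_on (U : set C) (g : C -> C) : Prop :=
  forall z, U z -> derivable g z 1.

(* [g] is a branch on [U] of the multivalued function
   \prod_i (x - a_i)^(b_i): near each point of [U] it is
   exp (\sum_i b_i L_i(x)) for some local branches L_i of log (x - a_i).
   The L_i are only local, since [g] may be single-valued on [U] when the
   logarithms are not. *)
Definition is_branch (k : nat) (a b : 'I_k -> C) (U : set C) (g : C -> C) :
    Prop :=
  holomorphic_on U g /\
  forall z, U z -> exists (V : set C) (L : 'I_k -> C -> C),
    [/\ open V, V z & V `<=` U] /\
    [/\ forall i, holomorphic_on V (L i),
        forall i x, V x -> cexp (L i x) = x - a i
      & forall x, V x -> g x = cexp (\sum_(i < k) b i * L i x)].

(* Elements of C[x, y] are [F : {poly {poly C}}], where x is the outer variable: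
   F.[x, y] is F(x, y) and F`_i`_j is the coefficient of x^i y^j. *)
Definition total_degree_le (d : nat) (F : {poly {poly C}}) : Prop :=
  forall i j, (d < i + j)%N -> F`_i`_j = 0.

Definition quasi_invariant (m : nat) (U : set C) (f : C -> C) :
    set {poly {poly C}} :=
  [set F | exists h : C * C -> C,
    (forall p, (U `*` U) p -> differentiable h p) /\
    forall x y, U x -> U y -> x != y ->
      h (x, y) =
      (f x * F.[x, y] - f y * F.[y, x]) / (x - y) ^+ (2 * m + 1)].

(* {poly {poly C}} carries no canonical C-module structure; the scalar c acts
   as multiplication by c%:P%:P, that is as c%:P *: _ . *)
Definition has_dim (S : set {poly {poly C}}) (n : nat) : Prop :=
  exists e : 'I_n -> {poly {poly C}},
    [/\ forall c : 'I_n -> C,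
          \sum_(i < n) (c i)%:P *: e i = 0 -> forall i, c i = 0
      & S = [set F | exists c : 'I_n -> C, F = \sum_(i < n) (c i)%:P *: e i]].

(* [H] is the sequence of coefficients of the Hilbert series. *)
Definition is_hilbert_series (S : set {poly {poly C}}) (H : nat -> int) :
    Prop :=
  exists D : nat -> nat,
    (forall d, has_dim (S `&` total_degree_le d) (D d)) /\
    forall d, H d = (D d)%:Z - (if d is d'.+1 then D d' else 0%N)%:Z.

(* d_m(z); the condition says that z is the integer floor (Re z). *)
Definition dtrunc (m : nat) (z : C) : nat :=
  let n := Num.floor (complex.Re z) in
  if z == n%:~R then minn m `|n|%N else m.

Definition dtruncf (k : nat) (m : nat) (b : 'I_k -> C) : nat :=
  (\sum_(i < k) dtrunc m (b i))%N.

End TwistedQuasiInvariants.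

(* The identity D * (\sum_n H n t^n) = N of formal power series, i.e.
   \sum_n H n t^n = N / D whenever D`_0 is invertible. *)
Definition is_expansion (H : nat -> int) (N D : {poly int}) : Prop :=
  forall n, \sum_(i < n.+1) D`_i * H (n - i)%N = N`_n.

(* Main.v *)
(** Put x = u + v, y = u - v and write F(x, y) = sum_i g_i(u) v^i. The numerator
f(x) F(x, y) - f(y) F(y, x) is odd in v, so F is a quasi-invariant iff the coefficients of
v^1, v^3, ..., v^(2m-1) in prod_i (1 + v/(u - a_i))^(b_i) F vanish identically in u.

If g_0 = 0 then also g_1 = 0, and F = v^2 F' with F' in Q_(m-1)(f). Hence
dim Q_m(f)_(<= d) - dim Q_(m-1)(f)_(<= d-2) is governed by the ideal of the possible g_0,
and the Hilbert series follows by induction on m once this ideal is known to be generated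
by e = prod_i (u - a_i)^(d_m(b_i)), with a lift E of e to Q_m(f) of total degree d_m(f).

Products of quasi-invariants for f1 and f2 are quasi-invariants for f1 f2, so both claims
reduce to f = (x - a)^b, where everything is homogeneous in (u - a, v). There one has to
study polynomials p(w) such that (1 + w)^b p(w) is even modulo w^(2m). If deg p < m, the
Wronskian of (1 + w)^b p(w) and (1 - w)^b p(-w) must vanish, so that
((1 + w)/(1 - w))^b = p(-w)/p(w), which forces b to be an integer with |b| <= deg p. *)

Require Import Defs.
From HB Require Import structures.
From mathcomp Require Import all_boot all_order all_algebra.
From mathcomp Require Import all_classical all_reals all_analysis.
From mathcomp Require Import complex.
From mathcomp Require Import ring lra zify.

Set Implicit Arguments.
Unset Strict Implicit.
Unset Printing Implicit Defensive.

Import Order.TTheory GRing.Theory Num.Theory.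
Import numFieldNormedType.Exports.

Local Open Scope classical_set_scope.
Local Open Scope ring_scope.

(** * Truncated power series and the binomial series *)

(** Power series are replaced by polynomials truncated beyond order 2m, since the conditions only
    see coefficients below that order. The dimension count rests on E having no larger total degree
    than its constant term e: if g_0 = p e, then p E stays within the degree bound of F, and
    subtracting it leaves an element with g_0 = 0. To bound g_0 for a product f, the factors other
    than (x - a_i)^(b_i) are cancelled by lifts for their inverses; this works because d_m(-b) =
    d_m(b) and because the constant terms of those lifts are prime to u - a_i. The analytic obstacle
    is the diagonal: the quotient must be complex differentiable in two variables at points where no
    formula defines it. Both values of f are expanded at the midpoint u, with a remainder that is
    uniform in u and two orders smaller than v^(2m+1). After division, the quotient differs from an
    explicit differentiable function of u by O(distance^2), which suffices. In the other direction,
    local boundedness of the quotient is enough. *)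

Section Truncation.
Variable K : fieldType.
Implicit Types (p q r : {poly K}) (c : K) (m n N : nat).

Lemma dvdXnP n p : reflect (forall j, (j < n)%N -> p`_j = 0) ('X^n %| p).
Proof.
apply: (iffP idP) => [/dvdpP [q ->] j ltjn|p0]; first by rewrite coefMXn ltjn.
rewrite -[p](poly_take_drop n) dvdp_addr ?dvdp_mull //.
suff -> : take_poly n p = 0 by rewrite dvdp0.
by apply/polyP => i; rewrite coef_take_poly coef0; case: ifP => // /p0.
Qed.

Lemma dvdXn_unit n p q : q`_0 != 0 -> 'X^n %| q * p -> 'X^n %| p.
Proof.
move=> q0; rewrite Gauss_dvdpr // coprimep_expl // coprimep_sym.
by rewrite -[X in coprimep _ X]subr0 -polyC0 coprimep_XsubC /root horner_coef0.
Qed.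

Lemma coef_comp_scaleX c p j : (p \Po (c *: 'X))`_j = c ^+ j * p`_j.
Proof.
rewrite comp_polyE coef_sum.
under eq_bigr do rewrite exprZn !coefZ coefXn.
have [jp|jp] := ltnP j (size p).
  rewrite (bigD1 (Ordinal jp)) //= eqxx mulr1 mulrC big1 ?addr0 // => i /eqP ij.
  by case: eqP => [ji|_]; [case: ij; apply/val_inj|rewrite !mulr0].
rewrite big1 ?nth_default ?mulr0 // => i _.
by rewrite [j == i]gtn_eqF ?mulr0 // (leq_trans (ltn_ord i)).
Qed.

(** Membership in the subring K[w^2] + (w^(2m)) of K[w]; hence the stability under products. *)
Definition oddvan m p := forall j, odd j -> (j < 2 * m)%N -> p`_j = 0.

Lemma oddvanM m p q : oddvan m p -> oddvan m q -> oddvan m (p * q).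
Proof.
move=> hp hq j oj jm; rewrite coefM big1 // => i _.
have ij : (i <= j)%N by rewrite -ltnS.
have [oi|ei] := boolP (odd i); first by rewrite hp ?mul0r //; lia.
by rewrite hq ?mulr0 //; [rewrite oddB // oj (negbTE ei)|lia].
Qed.

Lemma oddvan_prod m (I : finType) (P : pred I) (F : I -> {poly K}) :
  (forall i, P i -> oddvan m (F i)) -> oddvan m (\prod_(i | P i) F i).
Proof.
move=> hF; elim/big_ind: _ => //; last exact: oddvanM.
by move=> j oj _; rewrite coef1; case: j oj.
Qed.

Lemma oddvanD m p q : oddvan m p -> oddvan m q -> oddvan m (p + q).
Proof. by move=> hp hq j oj jm; rewrite coefD hp ?hq ?addr0. Qed.

Lemma oddvanZ m c p : oddvan m p -> oddvan m (c *: p).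
Proof. by move=> hp j oj jm; rewrite coefZ hp ?mulr0. Qed.

Lemma oddvan_scale m c p : oddvan m p -> oddvan m (p \Po (c *: 'X)).
Proof. by move=> hp j oj jm; rewrite coef_comp_scaleX hp ?mulr0. Qed.

(** Allows a power series to be replaced by any truncation that is exact below order 2m. *)
Lemma oddvan_congr m N p q :
  (2 * m <= N)%N -> 'X^N %| p - q -> oddvan m q -> oddvan m p.
Proof.
move=> mN /dvdXnP pq hq j oj jm; rewrite -[p](subrK q) coefD pq ?hq ?addr0 //.
lia.
Qed.

(** Used twice: for the induction on m, and for the contradiction in [pade]. *)
Lemma oddvan_X2 m p : oddvan m.+1 ('X^2 * p) <-> oddvan m p.
Proof.
rewrite mulrC; split=> h j oj jm.
  by have := h j.+2; rewrite coefMXn /= subn2 negbK; apply => //; lia.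
rewrite coefMXn; case: ifP => // j2; apply: h; last lia.
by rewrite oddB ?oj //; lia.
Qed.

End Truncation.

Section BinomialSeries.
Variable K : numFieldType.
Implicit Types (p q r : {poly K}) (b c : K) (m n N : nat).

Fixpoint gbinom b n : K :=
  if n is n'.+1 then gbinom b n' * (b - n'%:R) / n'.+1%:R else 1.

Lemma gbinomS b n : n.+1%:R * gbinom b n.+1 = (b - n%:R) * gbinom b n.
Proof. by rewrite /= mulrC divfK ?pnatr_eq0 // mulrC. Qed.

(* The first [N] terms of the binomial series of [(1 + w)^b]. *)
Definition binser N b : {poly K} := \poly_(n < N) gbinom b n.

Lemma coef_binser N b n : (n < N)%N -> (binser N b)`_n = gbinom b n.
Proof. by move=> nN; rewrite coef_poly nN. Qed.

Lemma binser0 N b : (binser N.+1 b)`_0 = 1.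
Proof. by rewrite coef_binser. Qed.

(** (1 + w)^b solves (1 + w) y' = b y. Below order N its truncation obeys the same recursion, so
    only the top monomial survives. The exact coefficient of this defect later gives the analytic
    remainder in [cpow_taylor]. *)
Lemma binser_ode N b :
  (1 + 'X) * (binser N.+1 b)^`() - b *: binser N.+1 b
  = ((N%:R - b) * gbinom b N) *: 'X^N.
Proof.
apply/polyP => j; rewrite mulrDl mul1r coefB coefD coefXM !coefZ coefXn.
rewrite !coef_deriv.
have -> : (if j == 0%N then 0 else (binser N.+1 b)`_j.-1.+1 *+ j.-1.+1)
  = (binser N.+1 b)`_j *+ j by case: j.
rewrite !coef_poly; case: (ltngtP j N) => [jN|jN|->].
- have -> : (j.+1 < N.+1)%N = true by lia.
  have -> : (j < N.+1)%N = true by lia.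
  rewrite -(mulr_natl _ j.+1) -(mulr_natl _ j) gbinomS mulr0.
  by move: (gbinom b j) => g; ring.
- have -> : (j.+1 < N.+1)%N = false by lia.
  have -> : (j < N.+1)%N = false by lia.
  by rewrite !mul0rn !mulr0 addr0 subrr.
- rewrite ltnn leqnn mul0rn -(mulr_natl _ N) [true%:R]mulr1n mulr1.
  by move: (gbinom b N) => g; ring.
Qed.

(** In characteristic 0 the differential equation modulo w^N determines the coefficients recursively
    up to order N. Products and natural powers of binomial series are identified in this way,
    through the equations they satisfy. *)
Lemma binser_uniq N b p : p`_0 = 1 ->
  'X^N %| (1 + 'X) * p^`() - b *: p -> 'X^(N.+1) %| p - binser N.+1 b.
Proof.
move=> p0 /dvdXnP h; apply/dvdXnP => j; rewrite coefB ltnS => jN.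
rewrite coef_binser //; apply/eqP; rewrite subr_eq0; apply/eqP.
elim: j jN => [//|j IH jN].
have := h j jN; rewrite mulrDl mul1r coefB coefD coefXM coefZ !coef_deriv.
have -> : (if j == 0%N then 0 else p`_j.-1.+1 *+ j.-1.+1) = p`_j *+ j.
  by case: j {IH jN}.
rewrite IH; last exact: ltnW.
move=> /eqP; rewrite -addrA addr_eq0 => /eqP e.
apply: (@mulfI _ j.+1%:R); first by rewrite pnatr_eq0.
rewrite gbinomS mulr_natl e -mulr_natl.
by move: (gbinom b j) => g; ring.
Qed.

Lemma binserM N b c :
  'X^(N.+1) %| binser N.+1 b * binser N.+1 c - binser N.+1 (b + c).
Proof.
apply: binser_uniq; first by rewrite coef0M !binser0 mulr1.
set B := binser _ b; set B' := binser _ c.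
have -> : (1 + 'X) * (B * B')^`() - (b + c) *: (B * B') =
  ((1 + 'X) * B^`() - b *: B) * B' + B * ((1 + 'X) * B'^`() - c *: B').
  by rewrite derivM -!mul_polyC rmorphD /=; ring.
rewrite !binser_ode -!mul_polyC dvdp_add //; first by rewrite dvdp_mulr // dvdp_mull.
by rewrite dvdp_mull // dvdp_mull.
Qed.

Lemma binserNK N b : 'X^(N.+1) %| binser N.+1 b * binser N.+1 (- b) - 1.
Proof.
have -> : binser N.+1 b * binser N.+1 (- b) - 1 =
  (binser N.+1 b * binser N.+1 (- b) - binser N.+1 (b - b))
  - (1 - binser N.+1 (b - b)) by ring.
rewrite dvdp_sub ?binserM // binser_uniq ?coef1 //.
by rewrite subrr derivC mulr0 scale0r subrr dvdp0.
Qed.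

Lemma binser_nat N n : 'X^(N.+1) %| (1 + 'X) ^+ n - binser N.+1 n%:R.
Proof.
apply: binser_uniq.
  by rewrite -horner_coef0 horner_exp !hornerE expr1n.
have -> : (1 + 'X) * ((1 + 'X) ^+ n)^`() - n%:R *: (1 + 'X) ^+ n = 0 :> {poly K}.
  rewrite deriv_exp derivD derivX derivC add0r mul1r -mul_polyC polyC_natr.
  case: n => [|n]; first by rewrite !mulr0n; ring.
  by rewrite /= exprS -mulr_natl; ring.
by rewrite dvdp0.
Qed.

Definition flip p := p \Po (- 'X).

Lemma flipE p : flip p = p \Po ((-1) *: 'X).
Proof. by rewrite scaleN1r. Qed.

Lemma coef_flip p j : (flip p)`_j = (-1) ^+ j * p`_j.
Proof. by rewrite flipE coef_comp_scaleX. Qed.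

Lemma size_flip p : size (flip p) = size p.
Proof. by rewrite /flip size_comp_poly2 // size_polyN size_polyX. Qed.

Lemma deriv_flip p : (flip p)^`() = - flip p^`().
Proof. by rewrite /flip deriv_comp derivN derivX mulrN1. Qed.

Lemma flipM p q : flip (p * q) = flip p * flip q.
Proof. exact: comp_polyM. Qed.

Lemma flipD p q : flip (p + q) = flip p + flip q.
Proof. exact: comp_polyD. Qed.

Lemma flipN p : flip (- p) = - flip p.
Proof. by rewrite /flip rmorphN. Qed.

Lemma flipX : flip 'X = - 'X.
Proof. exact: comp_polyX. Qed.

Lemma flip1D : flip (1 + 'X) = 1 - 'X.
Proof. by rewrite /flip comp_polyD comp_polyX comp_polyC. Qed.

Lemma flip1B : flip (1 - 'X) = 1 + 'X.
Proof. by rewrite /flip comp_polyB comp_polyX comp_polyC opprK. Qed.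

Lemma flipC c : flip c%:P = c%:P.
Proof. exact: comp_polyC. Qed.

Lemma dvdXn_flip n p : 'X^n %| p -> 'X^n %| flip p.
Proof.
by move=> /dvdXnP h; apply/dvdXnP => j jn; rewrite coef_flip h ?mulr0.
Qed.

(* [(1 - w^2)^(1 - b)] times the Wronskian of [(1 + w)^b p(w)] and its reflection. *)
Definition wron b p : {poly K} :=
  (2 * b)%:P * p * flip p
  + (1 - 'X ^+ 2) * (p^`() * flip p + p * flip p^`()).

Lemma size_wron b p d : (size p <= d.+1)%N -> (size (wron b p) <= 2 * d + 2)%N.
Proof.
move=> sp.
have sp' : (size p^`() <= d)%N.
  by have [->|/lt_size_deriv] := eqVneq p 0; [rewrite deriv0 size_poly0|lia].
have s1 : (size (1 - 'X^2 : {poly K})%R <= 3)%N.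
  by rewrite (leq_trans (size_polyD _ _)) // size_polyN size_polyXn size_poly1.
rewrite /wron (leq_trans (size_polyD _ _)) // geq_max; apply/andP; split.
  rewrite mul_polyC -scalerAl (leq_trans (size_scale_leq _ _)) //.
  by rewrite (leq_trans (size_polyMleq _ _)) // size_flip; lia.
have s2 : (size (p^`() * flip p + p * flip p^`())%R <= 2 * d)%N.
  rewrite (leq_trans (size_polyD _ _)) // geq_max.
  by rewrite !(leq_trans (size_polyMleq _ _)) // size_flip; lia.
by rewrite (leq_trans (size_polyMleq _ _)) //; lia.
Qed.

(** The Wronskian [W] of phi and its reflection is also that of phi and phi - flip phi up to sign,
    and this difference vanishes to order 2m + 1; so [W] vanishes to order 2m. Multiplied by 1 - w^2
    it becomes [wron b p] times the unit [B * flip B], up to the defects of the differential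
    equation. *)
Lemma wron_oddvan N m b p : (2 * m <= N)%N ->
  oddvan m (binser N.+1 b * p) -> 'X^(2 * m) %| wron b p.
Proof.
move=> mN; set B := binser _ b; set phi := B * p => hodd.
have B0 : (B * flip B)`_0 != 0.
  by rewrite coef0M coef_flip !binser0 !mul1r oner_eq0.
apply: (dvdXn_unit B0).
(* This is one order more than [oddvan m] provides: at the even index 2m the difference cancels by
   itself. The extra order pays for the derivative below. *)
have hdelta : forall j, (j < (2 * m).+1)%N -> (phi - flip phi)`_j = 0.
  move=> j; rewrite coefB coef_flip -signr_odd ltnS leq_eqVlt.
  have [oj|ej] := boolP (odd j); last by rewrite mul1r subrr.
  by case/orP => [/eqP ej|jm]; [move: oj; rewrite ej; lia|rewrite hodd ?mulr0 ?subrr].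
set W := phi^`() * flip phi + phi * flip phi^`().
have hW : 'X^(2 * m) %| W.
  have -> : W = phi * (phi - flip phi)^`() - phi^`() * (phi - flip phi).
    by rewrite derivB deriv_flip /W; ring.
  apply: dvdp_sub; apply/dvdp_mull/dvdXnP => j jm; last first.
    by rewrite hdelta // ltnW.
  by rewrite coef_deriv hdelta ?mul0rn.
pose A := b%:P * p + (1 + 'X) * p^`().
have hA : 'X^(2 * m) %| (1 + 'X) * phi^`() - B * A.
  have -> : (1 + 'X) * phi^`() - B * A = ((1 + 'X) * B^`() - b *: B) * p.
    by rewrite /phi derivM /A -mul_polyC; ring.
  rewrite binser_ode dvdp_mulr // -mul_polyC dvdp_mull //.
  by rewrite dvdp_exp2l.
have hA' : 'X^(2 * m) %| (1 - 'X) * flip phi^`() - flip B * flip A.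
  have := dvdXn_flip hA; rewrite /flip comp_polyB -/(flip _) -/(flip (B * A)).
  by rewrite !flipM flip1D.
have -> : B * flip B * wron b p = (1 - 'X ^+ 2) * W
  - ((1 + 'X) * phi^`() - B * A) * ((1 - 'X) * flip B * flip p)
  - ((1 - 'X) * flip phi^`() - flip B * flip A) * ((1 + 'X) * B * p).
  rewrite /W [flip phi]flipM {2}/phi /A flipD !flipM flip1D flipC /wron polyCM.
  by rewrite polyC_natr; ring.
apply: dvdp_sub; last exact: dvdp_mulr.
by apply: dvdp_sub; [exact: dvdp_mull|exact: dvdp_mulr].
Qed.

Lemma oneBX2_neq0 : 1 - 'X ^+ 2 != 0 :> {poly K}.
Proof.
apply/eqP => /(congr1 (fun q => q.[0])) /eqP.
by rewrite !hornerE expr0n subr0 oner_eq0.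
Qed.

(* Dividing [p] by [w + 1] or [w - 1] amounts to shifting [b] by one; when
   neither divides [p], evaluation at [w = 1] gives [b = 0]. *)
Lemma wron_eq0 d b p : p != 0 -> (size p <= d.+1)%N -> wron b p = 0 ->
  exists2 n : int, b = n%:~R & (`|n| <= d)%N.
Proof.
elim: d => [|d IH] in b p *.
  move=> p0 sp w0; exists 0 => //.
  have /eqP := congr1 (fun q => q.[1]) w0.
  rewrite (size1_polyC sp) /wron flipC derivC mul0r /flip comp_polyC mulr0 addr0.
  rewrite ?mulr0 ?addr0 !hornerE /= !mulf_eq0 pnatr_eq0 /=.
  have /negbTE -> : p`_0 != 0.
    by apply: contra p0 => /eqP e; rewrite (size1_polyC sp) e polyC0.
  by rewrite !orbF => /eqP.
move=> p0 sp w0.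
have [r1|r1] := boolP (root p (-1)).
  have /factor_theorem[q pq] := r1.
  have q0 : q != 0 by apply: contra p0 => /eqP e; rewrite pq e mul0r.
  have sq : (size q <= d.+1)%N.
    by move: sp; rewrite pq size_Mmonic ?monicXsubC // size_XsubC addn2 ltnS.
  have {}pq : p = (1 + 'X) * q by rewrite pq polyCN polyC1; ring.
  have /(IH _ _ q0 sq) [n bn nd] : wron (b + 1) q = 0.
    apply: (@mulfI _ (1 - 'X ^+ 2)); rewrite ?mulr0 ?oneBX2_neq0 //.
    rewrite -w0 /wron pq derivM !flipM !flipD !flipM !flip1D derivD derivX derivC add0r.
    rewrite flipC flipX !polyCM (polyCD b) polyC_natr polyC1; ring.
  exists (n - 1); last lia.
  by rewrite rmorphB /= -bn addrK.
have [r2|r2] := boolP (root p 1).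
  have /factor_theorem[q pq] := r2.
  have q0 : q != 0 by apply: contra p0 => /eqP e; rewrite pq e mul0r.
  have sq : (size q <= d.+1)%N.
    by move: sp; rewrite pq size_Mmonic ?monicXsubC // size_XsubC addn2 ltnS.
  have {}pq : p = - ((1 - 'X) * q) by rewrite pq; ring.
  have /(IH _ _ q0 sq) [n bn nd] : wron (b - 1) q = 0.
    apply: (@mulfI _ (1 - 'X ^+ 2)); rewrite ?mulr0 ?oneBX2_neq0 //.
    rewrite -w0 /wron pq derivN derivM derivB derivX derivC sub0r !flipN !flipM.
    rewrite flip1B flipD !flipM flip1B flipN flipC.
    rewrite !polyCM (polyCB b) polyC_natr polyC1; ring.
  exists (n + 1); last lia.
  by rewrite rmorphD /= -bn subrK.
exists 0 => //.
have /eqP := congr1 (fun q => q.[1]) w0.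
rewrite /wron /flip !hornerE /= horner_comp !hornerE.
rewrite expr1n subrr mul0r addr0 !mulf_eq0 pnatr_eq0 /=.
by rewrite -!/(root _ _) (negbTE r1) (negbTE r2) !orbF => /eqP.
Qed.

(** The Wronskian is divisible by w^(2m) but has degree at most 2d + 1 < 2m, so it is zero. *)
Lemma oddvan_integral N m d b p : (2 * m <= N)%N -> (d < m)%N ->
  p != 0 -> (size p <= d.+1)%N -> oddvan m (binser N.+1 b * p) ->
  exists2 n : int, b = n%:~R & (`|n| <= d)%N.
Proof.
move=> mN dm p0 sp ho; apply: (wron_eq0 p0 sp); apply/eqP.
have := wron_oddvan mN ho; apply: contraLR => w0.
apply/negP => /(dvdp_leq w0); rewrite size_polyXn.
by move=> /leq_trans /(_ (size_wron b sp)); lia.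
Qed.

End BinomialSeries.

(** * Polynomial multipliers that make the binomial series even to high order *)

Section Pade.
Variable K : numFieldType.
Implicit Types (p q r : {poly K}) (b c : K) (m n N : nat).

(* [D = d_m(b)]. *)
Definition trunc_abs m b D :=
  (exists2 n : int, b = n%:~R & D = minn m `|n|%N)
  \/ D = m /\ forall n : int, b <> n%:~R.

Lemma trunc_abs_le m b D : trunc_abs m b D -> (D <= m)%N.
Proof. by case=> [[n _ ->]|[-> _]//]; exact: geq_minl. Qed.

Lemma trunc_abs_lt m b D d : trunc_abs m b D -> (d < D)%N ->
  ~ exists2 n : int, b = n%:~R & (`|n| <= d)%N.
Proof.
case=> [[n -> ->]|[-> bn]] dD [n' e nd]; last exact: bn e.
have : n = n' by apply: (@intr_inj K).
by move: dD nd; lia.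
Qed.

(** There are m linear conditions, one for each odd index below 2m, on m + 1 coefficients. *)
Lemma oddvan_kernel m q : exists2 p : {poly K}, (p != 0) && (size p <= m.+1)%N &
  oddvan m (q * p).
Proof.
pose M : 'M[K]_(m.+1, m) := \matrix_(i, l) (q * 'X^i)`_(2 * l + 1).
pose u := nz_row (kermx M).
have u0 : u != 0.
  rewrite nz_row_eq0 -mxrank_eq0 mxrank_ker subn_eq0 -ltnNge ltnS.
  exact: rank_leq_col.
have uM : u *m M = 0 by apply/sub_kermxP; exact: nz_row_sub.
pose p := \poly_(i < m.+1) u 0 (inord i).
have pE : p = \sum_(i < m.+1) u 0 i *: 'X^i.
  by rewrite /p poly_def; apply: eq_bigr => i _; rewrite inord_val.
exists p.
  rewrite size_poly andbT; apply: contra u0 => /eqP p0.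
  apply/eqP/rowP => i; rewrite mxE.
  by have := congr1 (fun r => r`_i) p0; rewrite coef_poly ltn_ord inord_val coef0.
move=> j oj jm.
have jl : (j./2 < m)%N by lia.
have je : j = (2 * (Ordinal jl) + 1)%N by move: (odd_double_half j); rewrite oj /=; lia.
have := congr1 (fun A : 'rV_m => A 0 (Ordinal jl)) uM; rewrite !mxE => e; rewrite -[RHS]e.
rewrite pE mulr_sumr coef_sum; apply: eq_bigr => i _.
by rewrite mxE -je -scalerAr coefZ.
Qed.

(* When [D = m], [p] is found by counting dimensions; if its constant term were zero,
   dividing it by [w^2] would contradict [oddvan_integral]. *)
Lemma pade m b D N : (2 * m <= N)%N -> trunc_abs m b D ->
  exists p, [/\ (size p <= D.+1)%N, p`_0 = 1 & oddvan m (binser N.+1 b * p)].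
Proof.
move=> mN hD; have [hint|hnint] := boolP (D < m)%N.
  case: hD hint => [[n -> ->] hn|[-> _]]; last by rewrite ltnn.
  have -> : minn m `|n| = `|n|%N by lia.
  have sX c : (size ((1 + c *: 'X) ^+ `|n| : {poly K})%R <= `|n|.+1)%N.
    rewrite (leq_trans (size_poly_exp_leq _ _)) // ltnS.
    have : (size (1 + c *: 'X : {poly K})%R <= 2)%N.
      rewrite (leq_trans (size_polyD _ _)) // size_poly1 geq_max /=.
      by rewrite (leq_trans (size_scale_leq _ _)) // size_polyX.
    by move: (size _) => s; nia.
  have X0 c : ((1 + c *: 'X) ^+ `|n| : {poly K})`_0 = 1.
    by rewrite -horner_coef0 horner_exp !hornerE ?mulr0 ?addr0 expr1n.
  (* For b = n >= 0 the multiplier (1 - w)^n gives the even product (1 - w^2)^n; for b = -n the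
     multiplier (1 + w)^n gives the product 1. *)
  case: (intP n) sX X0 {hn} => [|k|k] sX X0.
  - exists 1; rewrite size_poly1 coef1; split => //.
    apply: (@oddvan_congr _ _ N.+1 _ 1); first lia.
      by rewrite mulr1 -dvdpNr opprB -(expr0 (1 + 'X)) binser_nat.
    by move=> [|j] //; rewrite coef1.
  - exists ((1 + (-1) *: 'X) ^+ k.+1); split => //.
    apply: (@oddvan_congr _ _ N.+1 _ ((1 - 'X^2) ^+ k.+1)); first lia.
      have -> : binser N.+1 k.+1%:~R * (1 + -1 *: 'X) ^+ k.+1 - (1 - 'X^2) ^+ k.+1
        = - ((1 + 'X) ^+ k.+1 - binser N.+1 k.+1%:R) * (1 + -1 *: 'X) ^+ k.+1 :> {poly K}.
        have -> : (1 - 'X^2) = (1 + 'X) * (1 + -1 *: 'X) :> {poly K}.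
          by rewrite -mul_polyC polyCN polyC1; ring.
        rewrite exprMn -pmulrn; ring.
      by rewrite dvdp_mulr // dvdpNr binser_nat.
    move=> j oj _; have -> : (1 - 'X^2) ^+ k.+1 = ((1 - 'X) ^+ k.+1) \Po 'X^2 :> {poly K}.
      by rewrite rmorphXn rmorphB /= comp_polyX comp_polyC.
    by rewrite coef_comp_poly_Xn // dvdn2 oj.
  - exists ((1 + 1 *: 'X) ^+ k.+1); split => //.
    apply: (@oddvan_congr _ _ N.+1 _ 1); first lia.
      have -> : binser N.+1 (- k.+1%:Z)%:~R * (1 + 1 *: 'X) ^+ k.+1 - 1 =
        binser N.+1 (- k.+1%:R) * ((1 + 'X) ^+ k.+1 - binser N.+1 k.+1%:R)
        + (binser N.+1 k.+1%:R * binser N.+1 (- k.+1%:R) - 1) :> {poly K}.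
        by rewrite scale1r rmorphN /= -pmulrn; ring.
      by rewrite dvdp_add ?binserNK // dvdp_mull // binser_nat.
    by move=> [|j] //; rewrite coef1.
have {hnint} Dm : D = m by have := trunc_abs_le hD; lia.
rewrite Dm in hD *.
have [p /andP[p0 sp] ho] := oddvan_kernel m (binser N.+1 b).
have [p00|p00] := eqVneq (p`_0) 0; last first.
  exists ((p`_0)^-1 *: p); split.
  - by rewrite size_scale ?invr_eq0.
  - by rewrite coefZ mulVf.
  - by rewrite -scalerAr; exact: oddvanZ.
case: m => [|m] in mN Dm hD sp ho *.
  by case/eqP: p0; rewrite (size1_polyC sp) p00.
have p1 : p`_1 = 0.
  have h1 : (1 < 2 * m.+1)%N by lia.
  have := ho 1%N isT h1; rewrite coefM !big_ord_recl big_ord0 addr0 /=.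
  by rewrite p00 mulr0 addr0 subn0 binser0 mul1r.
have /dvdpP[q pq] : 'X^2 %| p by apply/dvdXnP => -[|[|]].
have q0 : q != 0 by apply: contra p0 => /eqP e; rewrite pq e mul0r.
have sq : ((size q).+2 <= m.+2)%N by move: sp; rewrite pq size_Mmonic ?monicXn // size_polyXn addn3.
(* The nonzero quotient [q] has degree below m and satisfies the evenness condition at level m, so b
   would be an integer with |b| <= m - 1, whereas D = m + 1. *)
exfalso; apply: (trunc_abs_lt hD (d := m.-1)); first lia.
case: m => [|m] in mN hD sp ho sq Dm *.
  by move: sq; rewrite !ltnS leqn0 size_poly_eq0 (negbTE q0).
apply: (@oddvan_integral _ N m.+1 _ b q) => //=; first lia.
by apply/oddvan_X2; rewrite mulrCA [_ * q]mulrC -pq.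
Qed.

End Pade.

(** * Total degree and bases *)

Section TotalDegree.
Variable K : fieldType.
Implicit Types (p q : {poly K}) (F G H : {poly {poly K}}) (c : K) (d n : nat).

(** The bound is strict so that level 0 contains only the zero polynomial; truncated differences
    such as d - 2 then give the right spaces. *)
Definition tdeg_lt d G := forall i j, (d <= i + j)%N -> G`_i`_j = 0.

Lemma tdeg_ltW d d' G : (d <= d')%N -> tdeg_lt d G -> tdeg_lt d' G.
Proof. by move=> dd h i j ij; apply: h; exact: leq_trans ij. Qed.

Lemma tdlt0 d : tdeg_lt d 0.
Proof. by move=> i j _; rewrite !coef0. Qed.

Lemma tdeg_ltD d G H : tdeg_lt d G -> tdeg_lt d H -> tdeg_lt d (G + H).
Proof. by move=> hG hH i j ij; rewrite !coefD hG ?hH ?addr0. Qed.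

Lemma tdeg_ltN d G : tdeg_lt d G -> tdeg_lt d (- G).
Proof. by move=> hG i j ij; rewrite !coefN hG ?oppr0. Qed.

Lemma tdeg_ltM d d' G H : tdeg_lt d G -> tdeg_lt d'.+1 H -> tdeg_lt (d + d') (G * H).
Proof.
move=> hG hH i j ij; rewrite coefM coef_sum big1 // => i' _.
rewrite coefM big1 // => j' _.
have [le|lt] := leqP d (i' + j'); first by rewrite hG ?mul0r.
rewrite hH ?mulr0 //; have := ltn_ord i'; have := ltn_ord j'; lia.
Qed.

Lemma tdeg_ltC d p : (size p <= d)%N -> tdeg_lt d p%:P.
Proof.
move=> sp [|i] j ij; rewrite coefC /= ?coef0 // nth_default //.
by rewrite (leq_trans sp).
Qed.

Lemma tdlt1 : tdeg_lt 1 1.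
Proof. by rewrite -polyC1; apply: tdeg_ltC; rewrite size_poly1. Qed.

Lemma tdeg_ltX n : tdeg_lt n.+1 'X^n.
Proof.
move=> i j ij; rewrite coefXn; case: eqP => [e|_]; rewrite ?coef0 // coef1.
by case: j ij => // ; lia.
Qed.

Lemma tdeg_lt_prod (I : finType) (P : pred I) (E : I -> {poly {poly K}}) (D : I -> nat) :
  (forall i, P i -> tdeg_lt (D i).+1 (E i)) ->
  tdeg_lt (\sum_(i | P i) D i).+1 (\prod_(i | P i) E i).
Proof.
move=> h; elim/big_rec2: _ => [|i d G Pi hG]; first exact: tdlt1.
by rewrite mulrC addnC -addSn; apply: tdeg_ltM => //; exact: h.
Qed.

Lemma tdeg_lt_size d G : tdeg_lt d G -> (size (G`_0)%R <= d)%N.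
Proof. by move=> h; apply/leq_sizeP => j dj; apply: h. Qed.

Lemma dvdX2_split G : G`_0 = 0 -> G`_1 = 0 -> G = 'X^2 * drop_poly 2 G.
Proof.
move=> g0 g1; rewrite mulrC -[LHS](poly_take_drop 2).
suff -> : take_poly 2 G = 0 by rewrite add0r.
by apply/polyP => -[|[|i]]; rewrite coef_take_poly ?g0 ?g1 coef0.
Qed.

Lemma tdeg_lt_drop d G : tdeg_lt d G -> tdeg_lt (d - 2) (drop_poly 2 G).
Proof. by move=> h i j ij; rewrite coef_drop_poly; apply: h; lia. Qed.

Definition has_basis (S : {poly {poly K}} -> Prop) n :=
  exists e : 'I_n -> {poly {poly K}},
    (forall c : 'I_n -> K, \sum_(i < n) (c i)%:P *: e i = 0 -> forall i, c i = 0)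
    /\ forall F, S F <-> exists c : 'I_n -> K, F = \sum_(i < n) (c i)%:P *: e i.

Lemma has_basis0 S : (forall F, S F <-> F = 0) -> has_basis S 0.
Proof.
move=> hS; exists (fun _ => 0); split=> [c _ []//|F].
by rewrite hS; split=> [->|[c ->]]; [exists (fun=> 0)|]; rewrite big_ord0.
Qed.

(** Taking the coefficient of v^0 kills 'X^(k.+1) * G and sends p E to p E_0 with E_0 nonzero, so
    the sum is direct. The case k = 0 counts all polynomials of bounded degree; k = 1 is the
    induction on m. *)
Lemma has_basis_ext S S' k (E : {poly {poly K}}) n1 n2 : E`_0 != 0 ->
  (forall F, S' F <-> exists G p,
     [/\ S G, (size p <= n2)%N & F = 'X^(k.+1) * G + p%:P * E]) ->
  has_basis S n1 -> has_basis S' (n1 + n2).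
Proof.
move=> E0 hS' [e [efree eS]].
pose f (i : 'I_n1 + 'I_n2) : {poly {poly K}} :=
  match i with inl i => 'X^(k.+1) * e i | inr j => ('X^j)%:P * E end.
have sumE (c : 'I_n1 + 'I_n2 -> K) :
    \sum_(i < n1 + n2) (c (fintype.split i))%:P *: f (fintype.split i)
    = 'X^(k.+1) * (\sum_(i < n1) (c (inl i))%:P *: e i)
      + (\sum_(j < n2) c (inr j) *: 'X^j)%:P * E.
  rewrite big_split_ord /= mulr_sumr rmorph_sum /= mulr_suml.
  congr (_ + _); apply: eq_bigr => i _; rewrite (unsplitK (inl _)) || rewrite (unsplitK (inr _)).
    by rewrite /f -!mul_polyC mulrCA.
  by rewrite /f -[LHS]mul_polyC -[_ *: 'X^_]mul_polyC polyCM mulrA.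
exists (fun i => f (fintype.split i)); split.
  move=> c; have -> : \sum_(i < n1 + n2) (c i)%:P *: f (fintype.split i) =
      \sum_(i < n1 + n2) ((c \o unsplit) (fintype.split i))%:P *: f (fintype.split i).
    by apply: eq_bigr => i _; rewrite /= splitK.
  rewrite sumE => h.
  have p0 : \sum_(j < n2) (c \o @unsplit _ _) (inr j) *: 'X^j = 0.
    have := congr1 (fun F => F`_0) h.
    rewrite coefD coefXnM coefCM coef0 /= add0r => /eqP.
    by rewrite mulf_eq0 (negbTE E0) orbF => /eqP.
  move: h; rewrite p0 polyC0 mul0r addr0 => /eqP.
  rewrite mulf_eq0 expf_eq0 polyX_eq0 /= => /eqP /efree c0.
  move=> i; rewrite -(splitK i); case: (fintype.split i) => j; first exact: c0.
  have := congr1 (fun q => q`_j) p0; rewrite coef0 coef_sum (bigD1 j) //=.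
  rewrite coefZ coefXn eqxx mulr1 big1 ?addr0 // => j' /eqP jj'.
  rewrite coefZ coefXn; case: eqP => [ej|_]; last by rewrite mulr0.
  by case: jj'; apply/val_inj.
move=> F; rewrite hS'; split.
  move=> [G [p [/eS [c ->] sp ->]]].
  exists (fun i => match fintype.split i with inl i => c i | inr j => p`_j end).
  rewrite (sumE (fun i => match i with inl i => c i | inr j => p`_j end)) /=.
  congr (_ + _ %:P * _); rewrite -(poly_def n2 (fun j => p`_j)).
  apply/polyP => j; rewrite coef_poly; case: ltnP => // nj.
  by rewrite nth_default // (leq_trans sp).
move=> [c ->].
exists (\sum_(i < n1) (c (unsplit (inl i)))%:P *: e i).
exists (\sum_(j < n2) c (unsplit (inr j)) *: 'X^j); split.
- by apply/eS; eexists.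
- apply: (leq_trans (size_sum _ _ _)); apply/bigmax_leqP => j _.
  by rewrite (leq_trans (size_scale_leq _ _)) // size_polyXn.
rewrite -(sumE (c \o @unsplit _ _)).
by apply: eq_bigr => i _; rewrite /= splitK.
Qed.

End TotalDegree.

(** * Quasi-invariants in the coordinates u, v *)

Section AlgebraicQuasiInvariants.
Variable K : numFieldType.
(** Plays the part of [U], as a Zariski dense set of base points u. *)
Variable A : K -> Prop.
Hypothesis infA : forall p : {poly K}, (forall x, A x -> p.[x] = 0) -> p = 0.
Variable N : nat.
Implicit Types (p q : {poly K}) (F G H : {poly {poly K}}) (a b c u : K).
Implicit Types (d m n : nat) (T : K -> {poly K}).

(* The outer variable of [G] is [v], the inner one is [u]. *)
Definition ateval u G : {poly K} := map_poly (horner_eval u) G.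

Lemma coef_ateval u G i : (ateval u G)`_i = (G`_i).[u].
Proof. by rewrite coef_map. Qed.

Lemma atevalM u G H : ateval u (G * H) = ateval u G * ateval u H.
Proof. exact: rmorphM. Qed.

Lemma atevalD u G H : ateval u (G + H) = ateval u G + ateval u H.
Proof. exact: rmorphD. Qed.

Lemma ateval_prod u (I : finType) (P : pred I) (E : I -> {poly {poly K}}) :
  ateval u (\prod_(i | P i) E i) = \prod_(i | P i) ateval u (E i).
Proof. exact: rmorph_prod. Qed.

(* The Taylor polynomial of degree [N] in [v] of [((u + v - a) / (u - a))^b]. *)
Definition tser a b u : {poly K} := binser N.+1 b \Po ((u - a)^-1 *: 'X).

Lemma tser0 a b u : (tser a b u)`_0 = 1.
Proof. by rewrite coef_comp_scaleX expr0 mul1r binser0. Qed.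

Lemma tserNK a b u : 'X^(N.+1) %| tser a b u * tser a (- b) u - 1.
Proof.
have -> : tser a b u * tser a (- b) u - 1 =
    (binser N.+1 b * binser N.+1 (- b) - 1) \Po ((u - a)^-1 *: 'X).
  by rewrite rmorphB rmorphM /= comp_polyC.
apply/dvdXnP => j jN; rewrite coef_comp_scaleX.
by have /dvdXnP -> := binserNK N b; rewrite ?mulr0.
Qed.

(** The multiplier [T] is a parameter because it will be a single factor of f, the inverse of one,
    or the full product [tsers]. *)
Definition qinv m T G := forall u, A u -> oddvan m (T u * ateval u G).

Lemma qinv_prod m (I : finType) (P : pred I) (T : I -> K -> {poly K})
    (E : I -> {poly {poly K}}) :
  (forall i, P i -> qinv m (T i) (E i)) ->
  qinv m (fun u => \prod_(i | P i) T i u) (\prod_(i | P i) E i).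
Proof.
move=> h u Au; rewrite ateval_prod -big_split /=.
by apply: oddvan_prod => i Pi; apply: h.
Qed.

Lemma qinvD m T G H : qinv m T G -> qinv m T H -> qinv m T (G + H).
Proof.
by move=> hG hH u Au; rewrite atevalD mulrDr; apply: oddvanD; [apply: hG|apply: hH].
Qed.

Lemma qinvZ m T p G : qinv m T G -> qinv m T (p%:P * G).
Proof.
move=> hG u Au; rewrite atevalM.
have -> : ateval u p%:P = p.[u]%:P by rewrite /ateval map_polyC.
by rewrite mul_polyC -scalerAr; apply/oddvanZ/hG.
Qed.

Lemma qinv_X2 m T G : qinv m.+1 T ('X^2 * G) <-> qinv m T G.
Proof.
have e u : T u * ateval u ('X^2 * G) = 'X^2 * (T u * ateval u G).
  by rewrite atevalM /ateval map_polyXn mulrCA.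
by split=> h u Au; have := h u Au; rewrite e oddvan_X2.
Qed.

(** E is the homogenisation (u - a)^D p(v / (u - a)) of the multiplier p from [pade]; it is a
    polynomial because deg p <= D. *)
Lemma linear_factor_qinv m a b D : (2 * m <= N)%N -> trunc_abs m b D ->
  (forall u, A u -> u != a) ->
  exists E, [/\ qinv m (tser a b) E, E`_0 = ('X - a%:P) ^+ D & tdeg_lt D.+1 E].
Proof.
move=> mN hD Aa; have [p [sp p0 hp]] := pade mN hD.
exists (\poly_(i < D.+1) (p`_i *: ('X - a%:P) ^+ (D - i))); split.
- move=> u /Aa ua; have ua0 : u - a != 0 by rewrite subr_eq0.
  have -> : ateval u (\poly_(i < D.+1) (p`_i *: ('X - a%:P) ^+ (D - i))) =
      (u - a) ^+ D *: (p \Po ((u - a)^-1 *: 'X)).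
    apply/polyP => i; rewrite coef_ateval coefZ coef_comp_scaleX coef_poly.
    case: ltnP => iD; last first.
      by rewrite horner0 [p`_i]nth_default ?mulr0 // (leq_trans sp).
    rewrite hornerZ horner_exp hornerXsubC mulrA mulrC exprVn; congr (_ * _).
    by rewrite exprB ?unitfE.
  rewrite -scalerAr; apply: oddvanZ; rewrite -rmorphM /=.
  exact: oddvan_scale.
- by rewrite coef_poly /= p0 scale1r subn0.
move=> i j ij; rewrite coef_poly; case: ltnP => iD; rewrite ?coef0 //.
rewrite nth_default // (leq_trans (size_scale_leq _ _)) // size_exp_XsubC.
lia.
Qed.

(** By homogeneity in (u - a, v), each homogeneous component of G satisfies the condition
    separately. In degree d < D the component amounts to a polynomial in w of degree at most d,
    which [oddvan_integral] forces to vanish. *)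
Lemma qinv_linear_dvd m a b D G : (2 * m <= N)%N -> trunc_abs m b D ->
  (forall u, A u -> u != a) -> qinv m (tser a b) G ->
  ('X - a%:P) ^+ D %| G`_0.
Proof.
move=> mN hD Aa hG.
(* [ps d] is the coefficient of [s ^ d] in [G (a + s, s w)], as a polynomial in [w]. *)
pose ps d := \poly_(i < d.+1) (G`_i \Po ('X + a%:P))`_(d - i).
have hps d : oddvan m (binser N.+1 b * ps d).
  move=> j oj jm.
  (* In the variable s = u - a, this is s^j times the coefficient of v^j in the product of the
     series with G. It has no denominators and vanishes on [A], hence identically. *)
  pose S := \sum_(i < j.+1) gbinom b (j - i) *: ('X^i * (G`_i \Po ('X + a%:P))).
  have SE : S`_d = (binser N.+1 b * ps d)`_j.
    rewrite coefMr coef_sum; apply: eq_bigr => i _.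
    rewrite coefZ coefXnM coef_binser; last by have := ltn_ord i; lia.
    by rewrite coef_poly ltnS ltnNge; case: leqP.
  rewrite -SE; suff -> : S = 0 by rewrite coef0.
  have /eqP : S \Po ('X - a%:P) = 0.
    apply: infA => u Au; have ua0 : u - a != 0 by rewrite subr_eq0 Aa.
    rewrite horner_comp hornerXsubC /S horner_sum.
    have := hG u Au j oj jm; rewrite coefMr => e.
    transitivity ((u - a) ^+ j * 0); last by rewrite mulr0.
    rewrite -[X in _ = _ * X]e mulr_sumr; apply: eq_bigr => i _.
    rewrite hornerZ hornerM horner_exp hornerX horner_comp hornerD hornerX hornerC subrK.
    rewrite coef_ateval coef_comp_scaleX coef_binser; last by have := ltn_ord i; lia.
    have ij : (i <= j)%N by rewrite -ltnS.
    rewrite exprVn -[in (u - a) ^+ j](subnK ij) exprD.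
    have : (u - a) ^+ (j - i) != 0 by rewrite expf_neq0.
    by move: (gbinom _ _) (_ ^+ (j - i)) (_ ^+ i) => x y z y0; field.
  by rewrite comp_poly2_eq0 ?size_XsubC // => /eqP.
have ps0 d : (d < D)%N -> ps d = 0.
  move=> dD; apply/eqP; apply: contraT => p0; exfalso.
  apply: (trunc_abs_lt hD dD).
  apply: (oddvan_integral mN _ p0 _ (hps d)); last exact: size_poly.
  exact: leq_trans dD (trunc_abs_le hD).
have /dvdpP[q e] : 'X^D %| G`_0 \Po ('X + a%:P).
  apply/dvdXnP => d /ps0 /(congr1 (fun p => p`_0)).
  by rewrite coef_poly coef0 subn0.
rewrite -[G`_0](comp_polyXaddC_K _ a) e comp_polyM comp_Xn_poly.
exact: dvdp_mull.
Qed.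

Lemma coprimep_prodr (I : eqType) (r : seq I) (P : pred I) (f : I -> {poly K}) q :
  (forall i, P i -> coprimep q (f i)) -> coprimep q (\prod_(i <- r | P i) f i).
Proof.
move=> h; elim/big_rec: _ => [|i p Pi hp]; first exact: coprimep1.
by rewrite coprimepMr h.
Qed.

Lemma prod_coprime_dvd (I : finType) (f : I -> {poly K}) q :
  (forall i j, i != j -> coprimep (f i) (f j)) -> (forall i, f i %| q) ->
  \prod_i f i %| q.
Proof.
move=> cf df; rewrite -big_enum; have := enum_uniq I.
elim: (enum I) => [|i r IH] /=; first by rewrite big_nil dvd1p.
move=> /andP[ir ur]; rewrite big_cons Gauss_dvdp ?df ?IH //.
rewrite big_seq; apply: coprimep_prodr => j jr; apply: cf.
by apply: contraNneq ir => ->.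
Qed.

Lemma dvd_prod_sub1 (I : finType) (P : pred I) (f : I -> {poly K}) q :
  (forall i, P i -> q %| f i - 1) -> q %| \prod_(i | P i) f i - 1.
Proof.
move=> h; elim/big_rec: _ => [|i p Pi hp]; first by rewrite subrr dvdp0.
have -> : f i * p - 1 = (f i - 1) * p + (p - 1) by ring.
by rewrite dvdp_add // dvdp_mulr ?h.
Qed.

Variables (k : nat) (a b : 'I_k -> K).
Hypothesis inja : injective a.
Hypothesis Aa : forall u i, A u -> u != a i.

Definition tsers u := \prod_(i < k) tser (a i) (b i) u.

Lemma tsers0 u : (tsers u)`_0 = 1.
Proof.
rewrite /tsers -horner_coef0 horner_prod big1 // => i _.
by rewrite horner_coef0 tser0.
Qed.

Lemma trunc_absN m c D : trunc_abs m c D -> trunc_abs m (- c) D.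
Proof.
case=> [[n -> ->]|[-> h]]; [left|right].
  by exists (- n); rewrite ?rmorphN // abszN.
by split=> // n e; apply: (h (- n)); rewrite rmorphN /= -e opprK.
Qed.

Section Level.
Variables (m : nat) (D : 'I_k -> nat).
Hypothesis mN : (2 * m <= N)%N.
Hypothesis hD : forall i, trunc_abs m (b i) (D i).

Lemma qinv_generator : exists E : {poly {poly K}},
  [/\ qinv m tsers E, E`_0 = \prod_i ('X - (a i)%:P) ^+ D i
    & tdeg_lt (\sum_i D i).+1 E].
Proof.
have /fin_all_exists[E hE] i : exists E, [/\ qinv m (tser (a i) (b i)) E,
    E`_0 = ('X - (a i)%:P) ^+ D i & tdeg_lt (D i).+1 E].
  by apply: linear_factor_qinv => // u /Aa.
exists (\prod_i E i); split.
- by apply: qinv_prod => i _; have [] := hE i.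
- rewrite -horner_coef0 horner_prod; apply: eq_bigr => i _.
  by rewrite horner_coef0; have [] := hE i.
by apply: tdeg_lt_prod => i _; have [] := hE i.
Qed.

(* Multiplying [G] by quasi-invariants of the inverses of the other factors
   of [f] reduces the statement at [a i] to the single factor [(x - a i)^(b i)]. *)
Lemma qinv_dvd G : qinv m tsers G -> \prod_i ('X - (a i)%:P) ^+ D i %| G`_0.
Proof.
move=> hG; apply: prod_coprime_dvd => [i j ij|i].
  rewrite coprimep_expl // coprimep_expr // coprimep_XsubC2 // subr_eq0.
  by apply: contra_neq ij => /inja.
have /fin_all_exists[E hE] j : exists E, [/\ qinv m (tser (a j) (- b j)) E,
    E`_0 = ('X - (a j)%:P) ^+ D j & tdeg_lt (D j).+1 E].
  by apply: linear_factor_qinv => // [|u /Aa//]; exact: trunc_absN.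
pose H := G * \prod_(j | j != i) E j.
have hH : qinv m (tser (a i) (b i)) H.
  move=> u Au; apply: (@oddvan_congr _ _ N.+1 _
    (tsers u * ateval u G * (\prod_(j | j != i) (tser (a j) (- b j) u * ateval u (E j))))).
  - lia.
  - have -> : tsers u = tser (a i) (b i) u * \prod_(j | j != i) tser (a j) (b j) u.
      by rewrite /tsers (bigD1 i).
    rewrite /H atevalM ateval_prod big_split /=.
    set t := tser _ _ u; set P1 := \prod_(j | _) tser _ (b j) u.
    set P2 := \prod_(j | _) tser _ (- b j) u; set P3 := \prod_(j | _) ateval u _.
    set g := ateval u G.
    have -> : t * (g * P3) - t * P1 * g * (P2 * P3) = - (P1 * P2 - 1) * (t * g * P3).
      by ring.
    rewrite dvdp_mulr // dvdpNr -big_split /=.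
    by apply: dvd_prod_sub1 => j _; exact: tserNK.
  - apply: oddvanM; first exact: hG.
    by apply: oddvan_prod => j _; have [h _ _] := hE j; exact: h.
have := qinv_linear_dvd mN (hD i) (fun u => @Aa u i) hH.
(* The multipliers have constant terms (u - a_j)^(D_j) with j different from i, which are prime to u
   - a_i. *)
rewrite /H coef0M Gauss_dvdpl // -horner_coef0 horner_prod.
apply: coprimep_prodr => j ji; rewrite horner_coef0; have [_ -> _] := hE j.
rewrite coprimep_expl // coprimep_expr // coprimep_XsubC2 // subr_eq0.
by apply: contra_neq ji => /inja.
Qed.

End Level.

(** The multiplier has constant term 1, so once G_0 = 0 the coefficient of v in the product is G_1,
    and level m + 1 makes it vanish. *)
Lemma qinv_div_X2 m G : qinv m.+1 tsers G -> G`_0 = 0 ->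
  G = 'X^2 * drop_poly 2 G.
Proof.
move=> hG g0; apply: dvdX2_split => //; apply: infA => u Au.
have h1 : (1 < 2 * m.+1)%N by lia.
have := hG u Au 1%N isT h1; rewrite coefM !big_ord_recl big_ord0 addr0 /=.
by rewrite !coef_ateval /= g0 horner0 mulr0 addr0 tsers0 mul1r.
Qed.

(** The degree of G_0 bounds that of p, and the total degree of E is at most that of E_0; therefore
    G - p E still satisfies the bound d. *)
Lemma qinv_step m (D : 'I_k -> nat) d E :
  (2 * m.+1 <= N)%N -> (forall i, trunc_abs m.+1 (b i) (D i)) ->
  qinv m.+1 tsers E -> E`_0 = \prod_i ('X - (a i)%:P) ^+ D i ->
  tdeg_lt (\sum_i D i).+1 E ->
  forall G, qinv m.+1 tsers G /\ tdeg_lt d G <->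
    exists H p, [/\ qinv m tsers H /\ tdeg_lt (d - 2) H,
      (size p <= d - \sum_i D i)%N & G = 'X^2 * H + p%:P * E].
Proof.
move=> mN hD hE E0 tE G; split.
  move=> [hG tG]; have /dvdpP[p ep] := qinv_dvd mN hD hG.
  have sp : (size p <= d - \sum_i D i)%N.
    have [->|p0] := eqVneq p 0; first by rewrite size_poly0.
    have := tdeg_lt_size tG; rewrite ep size_Mmonic //; last first.
      by apply: monic_prod => i _; rewrite monic_exp ?monicXsubC.
    rewrite size_prod; last by move=> i _; rewrite expf_neq0 ?polyXsubC_eq0.
    under eq_bigr do rewrite size_exp_XsubC -addn1.
    rewrite big_split /= sum1_card -addSn addnK addnS /=; lia.
  pose H := G - p%:P * E.
  have hH : qinv m.+1 tsers H.
    by rewrite /H -mulNr -polyCN; apply: qinvD => //; apply: qinvZ.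
  have H0 : H`_0 = 0 by rewrite coefB coefCM ep E0 subrr.
  have eH := qinv_div_X2 hH H0.
  exists (drop_poly 2 H), p; split => //; last by rewrite -eH subrK.
  split; first by apply/qinv_X2; rewrite -eH.
  (* For nonzero p the difference d - sum D_i is positive, hence not truncated, and it bounds the
     degree of p E; for p = 0 it may be truncated. *)
  have [p0|p0] := eqVneq p 0.
    by apply: tdeg_lt_drop; rewrite /H p0 polyC0 mul0r subr0.
  apply: tdeg_lt_drop; apply: tdeg_ltD => //; apply: tdeg_ltN.
  have : (0 < size p)%N by rewrite size_poly_gt0.
  move=> p1; apply: (@tdeg_ltW _ (size p + \sum_i D i)); first lia.
  by apply: tdeg_ltM => //; exact: tdeg_ltC.
move=> [H [p [[hH tH] sp ->]]]; split.
  by apply: qinvD; [apply/qinv_X2|apply: qinvZ].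
have tX2 : tdeg_lt d ('X^2 * H).
  (* For d < 2 the bound d - 2 is truncated to 0, which forces H = 0. *)
  have [d2|d2] := ltnP d 2; last first.
    by rewrite mulrC -(subnK d2); apply: tdeg_ltM => //; exact: tdeg_ltX.
  suff -> : H = 0 by rewrite mulr0; exact: tdlt0.
  by apply/polyP => i; apply/polyP => j; rewrite !coef0 tH //; lia.
have [p0|p0] := eqVneq p 0; first by rewrite p0 polyC0 mul0r addr0.
have p1 : (0 < size p)%N by rewrite size_poly_gt0.
apply: tdeg_ltD => //; apply: (@tdeg_ltW _ (size p + \sum_i D i)); first lia.
by apply: tdeg_ltM => //; exact: tdeg_ltC.
Qed.

Lemma has_basis_congr (S S' : {poly {poly K}} -> Prop) n :
  (forall F, S F <-> S' F) -> has_basis S n -> has_basis S' n.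
Proof.
move=> SS' [e [efree eS]]; exists e; split=> // F.
by rewrite -SS'.
Qed.

Lemma has_basis_tdeg_lt d : has_basis (@tdeg_lt K d) 'C(d.+1, 2).
Proof.
elim: d => [|d IH].
  apply: has_basis0 => F; split=> [h|->]; last exact: tdlt0.
  by apply/polyP => i; apply/polyP => j; rewrite h ?coef0.
rewrite binS bin1; apply: (@has_basis_ext _ (@tdeg_lt K d) _ 0 1) => //.
  by rewrite coef1 oner_eq0.
move=> F; split=> [h|[G [p [hG sp ->]]]].
  exists (drop_poly 1 F), F`_0; split; last 1 first.
  - rewrite mulr1 mulrC -[LHS](poly_take_drop 1) addrC; congr (_ + _).
    by apply/polyP => -[|i]; rewrite coef_take_poly coefC.
  - by move=> i j ij; rewrite coef_drop_poly h // addn1.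
  - exact: tdeg_lt_size.
rewrite mulr1; apply: tdeg_ltD; last exact: tdeg_ltC.
by rewrite mulrC -addn1; apply: tdeg_ltM => //; exact: tdeg_ltX.
Qed.

Variable D : nat -> 'I_k -> nat.
Hypothesis hD : forall m i, trunc_abs m (b i) (D m i).

(** The initial value counts the monomials of degree below d. The truncation in both subtractions is
    intended: a summand is 0 until its generator fits under the bound. *)
Fixpoint qdim m d :=
  if m is m'.+1 then (qdim m' (d - 2) + (d - \sum_i D m i))%N else 'C(d.+1, 2).

Lemma has_basis_qinv m d : (2 * m <= N)%N ->
  has_basis (fun G => qinv m tsers G /\ tdeg_lt d G) (qdim m d).
Proof.
elim: m d => [|m IH] d mN.
  apply: has_basis_congr (has_basis_tdeg_lt d) => F.
  by split=> [h|[]//]; split=> // u _ j _; rewrite muln0.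
have [E [hE E0 tE]] := qinv_generator mN (hD m.+1).
apply: (@has_basis_ext _ (fun G => qinv m tsers G /\ tdeg_lt (d - 2) G) _ 1 E).
- rewrite E0; apply/prodf_neq0 => i _.
  by rewrite expf_neq0 ?polyXsubC_eq0.
- exact: qinv_step.
by apply: IH; lia.
Qed.

End AlgebraicQuasiInvariants.

(** * The generating function of the dimensions *)

Section Expansion.
Implicit Types (H : nat -> int) (P Q : {poly int}).

Definition expansion Q H n := \sum_(i < n.+1) Q`_i * H (n - i)%N.

(** Cutting the series down to a polynomial makes the ring laws of [{poly int}] available. *)
Lemma expansionE Q H M n : (n < M)%N ->
  expansion Q H n = (Q * \poly_(i < M) H i)`_n.
Proof.
move=> nM; rewrite coefM; apply: eq_bigr => i _.
by rewrite coef_poly (leq_ltn_trans (leq_subr _ _) nM).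
Qed.

Lemma expansion_shift Q H s n :
  expansion Q (fun n => if (s <= n)%N then H (n - s)%N else 0) n
  = if (s <= n)%N then expansion Q H (n - s) else 0.
Proof.
rewrite (@expansionE _ _ n.+1) //.
have -> : \poly_(i < n.+1) (if (s <= i)%N then H (i - s)%N else 0)
    = 'X^s * \poly_(i < n.+1 - s) H i.
  apply/polyP => i; rewrite coefXnM !coef_poly.
  case: (ltnP i s) => si; first by rewrite if_same.
  by have -> : (i - s < n.+1 - s)%N = (i < n.+1)%N by lia.
rewrite mulrCA coefXnM ltnNge; case: leqP => //= sn.
by rewrite -expansionE //; lia.
Qed.

Lemma expansionD Q H1 H2 n :
  expansion Q (fun n => H1 n + H2 n) n = expansion Q H1 n + expansion Q H2 n.
Proof. by rewrite -big_split; apply: eq_bigr => i _; rewrite mulrDr. Qed.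

Lemma eq_expansion Q H1 H2 n : H1 =1 H2 -> expansion Q H1 n = expansion Q H2 n.
Proof. by move=> e; apply: eq_bigr => i _; rewrite e. Qed.

Let Q2 : {poly int} := 1 - 'X^2.
Let Q := (1 - 'X) * Q2.

Lemma expansion1 n : expansion Q (fun=> 1) n = Q2`_n.
Proof.
rewrite (@expansionE _ _ n.+1) // /Q mulrAC.
have -> : (1 - 'X) * (\poly_(i < n.+1) 1) = 1 - 'X^(n.+1) :> {poly int}.
  rewrite -opprB mulNr -[RHS]opprB subrX1 poly_def; congr (- (_ * _)).
  by apply: eq_bigr => i _; rewrite scale1r.
by rewrite mulrBl mul1r coefB coefXnM ltnSn subr0.
Qed.

Variables (q : nat -> nat -> nat) (e : nat -> nat).
Hypothesis q0 : forall d, q 0 d = 'C(d.+1, 2).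
Hypothesis qS : forall m d, q m.+1 d = (q m (d - 2) + (d - e m.+1))%N.

Let H m n := (q m n.+1)%:Z - (q m n)%:Z.

Let q_0 m : q m 0 = 0%N.
Proof. by elim: m => [|m IH]; rewrite ?q0 // qS IH. Qed.

(** The recursion reads H_(m+1) = t^2 H_m + t^e / (1 - t) with e = e_(m+1). Multiplied by (1 - t)(1
    - t^2), the last term becomes t^e - t^(e+2), the new pair in the numerator. *)
Lemma hilbert_expansion m n :
  expansion Q (H m) n =
  ('X^(2 * m) + 'X^(2 * m + 1)
   + \sum_(1 <= i < m.+1) 'X^(2 * (m - i) + e i)
   - \sum_(1 <= i < m.+1) 'X^(2 * (m - i) + e i + 2))`_n.
Proof.
elim: m n => [|m IH] n.
  rewrite !big_geq // subr0 addr0 /=.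
  (* The coefficients at m = 0 are n + 1, so that H_0 = t H_0 + 1 / (1 - t). *)
  have HE : H 0 =1 (fun n => (if (1 <= n)%N then H 0 (n - 1)%N else 0) + 1).
    move=> [|d]; rewrite /H !q0 /=; first by [].
    rewrite subn1 /= (binS d.+2) (binS d.+1) !bin1; lia.
  elim: n => [|n IH].
    by rewrite /expansion big_ord1 /Q /Q2 coef0M /H !q0 !coefE.
  rewrite (eq_expansion _ _ HE) expansionD expansion_shift expansion1 /=.
  rewrite subn1 /= IH /Q2 !coefE.
  by case: n {IH} => [|[|n]].
have HE : H m.+1 =1 (fun n => (if (2 <= n)%N then H m (n - 2)%N else 0)
    + (if (e m.+1 <= n)%N then 1 else 0)).
  move=> d; rewrite /H !qS.
  have -> : (if (2 <= d)%N then (q m (d - 2).+1)%:Z - (q m (d - 2))%:Z else 0)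
      = (q m (d.+1 - 2))%:Z - (q m (d - 2))%:Z.
    case: d => [|[|d]] //=; rewrite ?q_0 ?subrr //.
    by rewrite !subn2.
  case: leqP; lia.
rewrite (eq_expansion _ _ HE) expansionD expansion_shift.
rewrite (expansion_shift _ (fun=> 1)) IH expansion1.
have cX s (P : {poly int}) : (if (s <= n)%N then P`_(n - s) else 0) = ('X^s * P)`_n.
  by rewrite coefXnM ltnNge; case: leqP.
rewrite !cX -coefD; apply: (congr1 (fun P : {poly int} => P`_n)).
rewrite !(@big_nat_recr _ _ _ m.+1) //= subnn muln0 add0n.
have sE (g g' : nat -> nat) : (forall i, (i <= m)%N -> g' i = (g i).+2) ->
    \sum_(1 <= i < m.+1) 'X^(g' i)
    = 'X^2 * \sum_(1 <= i < m.+1) 'X^(g i) :> {poly int}.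
  move=> gg; rewrite mulr_sumr; apply: eq_big_nat => i /andP[_ im].
  by rewrite -exprD gg.
rewrite (sE (fun i => 2 * (m - i) + e i)%N (fun i => 2 * (m.+1 - i) + e i)%N);
  last by move=> i im; lia.
rewrite (sE (fun i => 2 * (m - i) + e i + 2)%N
  (fun i => 2 * (m.+1 - i) + e i + 2)%N); last by move=> i im; lia.
rewrite /Q2 !exprD !mulnS !exprD; ring.
Qed.

End Expansion.

(** * The change of coordinates *)

Section Substitution.
Variable K : numFieldType.
Implicit Types (p : {poly K}) (F G A B : {poly {poly K}}) (c x y u v : K).

Lemma poly_inj_roots p (s : nat -> K) :
  injective s -> (forall n, p.[s n] = 0) -> p = 0.
Proof.
move=> injs ps; apply/eqP; apply: contraT => p0.
have := @max_poly_roots _ p (mkseq s (size p)) p0.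
rewrite size_mkseq ltnn; apply; last exact/mkseq_uniq.
by apply/allP => _ /mapP [n _ ->]; apply/eqP; exact: ps.
Qed.

Lemma poly_ext p : (forall x, p.[x] = 0) -> p = 0.
Proof.
move=> px; apply: (@poly_inj_roots _ (fun n => n%:R)) => // m n /eqP.
by rewrite eqr_nat => /eqP.
Qed.

Lemma horner2E F x y : F.[x, y] = \sum_(i < size F) (F`_i).[y] * x ^+ i.
Proof.
rewrite [F.[_]]horner_coef horner_sum; apply: eq_bigr => i _.
by rewrite hornerM -polyC_exp hornerC.
Qed.

Lemma horner2_ateval F x y : F.[x, y] = (ateval y F).[x].
Proof.
rewrite horner2E (@horner_coef_wide _ (size F)); last exact: size_poly.
by apply: eq_bigr => i _; rewrite coef_ateval.
Qed.

(** Turns identities between substitutions into identities between values, which [field] can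
    settle. *)
Lemma poly2_ext F G : (forall x y, F.[x, y] = G.[x, y]) -> F = G.
Proof.
move=> FG; apply/polyP => i; apply/eqP; rewrite -subr_eq0; apply/eqP.
apply: poly_ext => y; rewrite hornerD hornerN -!coef_ateval.
suff -> : ateval y F = ateval y G by rewrite subrr.
apply/eqP; rewrite -subr_eq0; apply/eqP; apply: poly_ext => x.
by rewrite hornerD hornerN -!horner2_ateval FG subrr.
Qed.

Definition subst2 A B F : {poly {poly K}} :=
  \sum_(i < size F) \sum_(j < size F`_i) (F`_i`_j)%:P%:P * (A ^+ i * B ^+ j).

Lemma horner2_subst A B F x y :
  (subst2 A B F).[x, y] = F.[A.[x, y], B.[x, y]].
Proof.
rewrite [in RHS]horner2E !horner_sum; apply: eq_bigr => i _.
rewrite !horner_sum horner_coef mulr_suml; apply: eq_bigr => j _.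
by rewrite !hornerM !hornerC !horner_exp -mulrA [in RHS](mulrC (_ ^+ j)).
Qed.

Lemma tdeg_ltXn A i : tdeg_lt 2 A -> tdeg_lt i.+1 (A ^+ i).
Proof.
move=> hA; elim: i => [|i IH]; first by rewrite expr0; exact: tdlt1.
by rewrite exprSr -[i.+2]addn1; apply: tdeg_ltM.
Qed.

Lemma tdeg_lt_sum (I : Type) (r : seq I) (P : pred I) (f : I -> {poly {poly K}}) d :
  (forall i, P i -> tdeg_lt d (f i)) -> tdeg_lt d (\sum_(i <- r | P i) f i).
Proof.
move=> h; elim/big_ind: _ => //; [exact: tdlt0|exact: tdeg_ltD].
Qed.

Lemma tdeg_lt_subst A B d F : tdeg_lt 2 A -> tdeg_lt 2 B -> tdeg_lt d F -> tdeg_lt d (subst2 A B F).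
Proof.
move=> hA hB hF; apply: tdeg_lt_sum => i _; apply: tdeg_lt_sum => j _.
have [ij|ij] := leqP d (i + j); first by rewrite hF // !polyC0 mul0r; exact: tdlt0.
apply: (@tdeg_ltW _ (1 + (i.+1 + j).-1)); first lia.
apply: tdeg_ltM; first by apply: tdeg_ltC; rewrite size_polyC; case: eqP.
by apply: (@tdeg_ltW _ (i.+1 + j)); first lia; apply: tdeg_ltM; exact: tdeg_ltXn.
Qed.

(* The change of variables [x = u + v], [y = u - v]. *)
Definition to_uv F := subst2 ('X%:P + 'X) ('X%:P - 'X) F.
Definition of_uv G := subst2 ((2^-1)%:P%:P * ('X - 'X%:P)) ((2^-1)%:P%:P * ('X + 'X%:P)) G.

Lemma horner2_to_uv F v u : (to_uv F).[v, u] = F.[u + v, u - v].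
Proof. by rewrite horner2_subst !(hornerD, hornerN, hornerX, hornerC). Qed.

Lemma horner2_of_uv G x y : (of_uv G).[x, y] = G.[2^-1 * (x - y), 2^-1 * (x + y)].
Proof. by rewrite horner2_subst !(hornerM, hornerD, hornerN, hornerX, hornerC). Qed.

Lemma to_uvK : cancel to_uv of_uv.
Proof.
move=> F; apply: poly2_ext => x y; rewrite horner2_of_uv horner2_to_uv.
by congr (_.[_, _]); field.
Qed.

Lemma of_uvK : cancel of_uv to_uv.
Proof.
move=> F; apply: poly2_ext => x y; rewrite horner2_to_uv horner2_of_uv.
by congr (_.[_, _]); field.
Qed.

Lemma tdeg_ltY : tdeg_lt 2 ('X%:P : {poly {poly K}}).
Proof. by apply: tdeg_ltC; rewrite size_polyX. Qed.

Lemma to_uv_tdeg_lt d F : tdeg_lt d F -> tdeg_lt d (to_uv F).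
Proof.
apply: tdeg_lt_subst; apply: tdeg_ltD; rewrite ?opprK //.
- exact: tdeg_ltY. - exact: (@tdeg_ltX K 1). - exact: tdeg_ltY.
- exact/tdeg_ltN/(@tdeg_ltX K 1).
Qed.

Lemma of_uv_tdeg_lt d G : tdeg_lt d G -> tdeg_lt d (of_uv G).
Proof.
have t1 : tdeg_lt 1 ((2^-1)%:P%:P : {poly {poly K}}).
  by apply: tdeg_ltC; rewrite size_polyC; case: eqP.
apply: tdeg_lt_subst; apply: (@tdeg_ltM _ 1 1) => //; apply: tdeg_ltD.
- exact: (@tdeg_ltX K 1). - exact/tdeg_ltN/tdeg_ltY.
- exact: (@tdeg_ltX K 1). - exact/tdeg_ltY.
Qed.

Lemma tdeg_lt_to_uv d F : tdeg_lt d (to_uv F) <-> tdeg_lt d F.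
Proof.
by split=> [h|]; [rewrite -(to_uvK F); exact: of_uv_tdeg_lt|exact: to_uv_tdeg_lt].
Qed.

Lemma horner2Z c F x y : (c%:P *: F).[x, y] = c * F.[x, y].
Proof. by rewrite hornerZ hornerM hornerC. Qed.

Lemma of_uv_comb n (c : 'I_n -> K) (e : 'I_n -> {poly {poly K}}) :
  of_uv (\sum_(i < n) (c i)%:P *: e i) = \sum_(i < n) (c i)%:P *: of_uv (e i).
Proof.
apply: poly2_ext => x y; rewrite horner2_of_uv !horner_sum; apply: eq_bigr => i _.
by rewrite !horner2Z horner2_of_uv.
Qed.

Lemma of_uv0 : of_uv 0 = 0.
Proof. by apply: poly2_ext => x y; rewrite horner2_of_uv !horner0. Qed.

Lemma has_basis_of_uv (S T : {poly {poly K}} -> Prop) n :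
  (forall F, T F <-> S (to_uv F)) -> has_basis S n -> has_basis T n.
Proof.
move=> TS [e [efree eS]]; exists (of_uv \o e); split.
  move=> c /(congr1 to_uv); rewrite -of_uv_comb of_uvK -[X in to_uv X]of_uv0 of_uvK.
  exact: efree.
move=> F; rewrite TS eS; split=> -[c ec]; exists c.
  by rewrite -of_uv_comb -ec to_uvK.
by rewrite ec -of_uv_comb of_uvK.
Qed.

End Substitution.

(** * Complex derivatives and the exponential *)

Section FirstOrder.
Variable K : numFieldType.
Implicit Types (g : K -> K) (x d e : K).

(** A quotient-free form of differentiability: it can be restricted to a real line through the point
    and split into real and imaginary parts. *)
Lemma is_derive_bound g x d : is_derive x (1 : K) g d ->
  forall e, 0 < e -> \forall h \near (0 : K), `|g (x + h) - g x - h * d| <= e * `|h|.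
Proof.
move=> [dg gd] e e0.
have : (fun h => h^-1 *: ((g \o shift x) (h *: (1 : K)) - g x)) @ 0^' --> d.
  by rewrite -gd.
move/cvgrPdist_le => /(_ e e0) => /nbhs_ballP[r r0 hr].
apply/nbhs_ballP; exists r => // h hb.
have [->|h0] := eqVneq h 0; first by rewrite addr0 subrr mul0r subrr normr0 mulr0.
have := hr h hb h0; rewrite /= => /(ler_wpM2r (normr_ge0 h)).
rewrite -normrM /GRing.scale /= mulr1 [h + x]addrC.
have -> : (d - h^-1 * (g (x + h) - g x)) * h = - (g (x + h) - g x - h * d) by field.
by rewrite normrN.
Qed.

Lemma bound_is_derive g x d :
  (forall e, 0 < e -> \forall h \near (0 : K), `|g (x + h) - g x - h * d| <= e * `|h|) ->
  is_derive x (1 : K) g d.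
Proof.
move=> hg.
have c : (fun h => h^-1 *: ((g \o shift x) (h *: (1 : K)) - g x)) @ 0^' --> d.
  apply/cvgrPdist_le => e e0.
  have := hg e e0 => /nbhs_ballP[r r0 hr].
  apply/nbhs_ballP; exists r => // h hb h0 /=.
  rewrite -(ler_pM2r (x := `|h|)) ?normr_gt0 // -normrM.
  rewrite /GRing.scale /= mulr1 [h + x]addrC.
  have -> : (d - h^-1 * (g (x + h) - g x)) * h = - (g (x + h) - g x - h * d) by field.
  by rewrite normrN; exact: hr.
by apply: DeriveDef; [apply: cvgP c|apply: cvg_lim c].
Qed.

End FirstOrder.

Section ComplexBasics.
Variable R : realType.
Local Notation C := (CC R).
Local Notation "x %:C" := (real_complex R x : C).
Implicit Types (z w v u : C) (x y r t : R).

Lemma normCR x : `|x%:C| = `|x|%:C.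
Proof. by rewrite (normc_def (x%:C : R[i])) /= expr0n addr0 sqrtr_sqr. Qed.

Lemma normC_re z : `|z| = (complex.Re `|z|)%:C.
Proof. by rewrite (normc_def (z : R[i])). Qed.

Lemma realCM x y : (x * y)%:C = x%:C * y%:C.
Proof. exact: rmorphM. Qed.

Lemma realCD x y : (x + y)%:C = x%:C + y%:C.
Proof. exact: rmorphD. Qed.

Lemma lecR x y : (x%:C <= y%:C) = (x <= y).
Proof. exact: lecR. Qed.

Lemma ltcR x y : (x%:C < y%:C) = (x < y).
Proof. exact: ltcR. Qed.

Lemma gt0C x : 0 < x -> 0 < x%:C.
Proof. by move=> x0; rewrite (ltcR 0). Qed.

Lemma ge0C x : 0 <= x -> 0 <= x%:C.
Proof. by move=> x0; rewrite (lecR 0). Qed.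

Lemma gt0_re e : 0 < e :> C -> exists2 r : R, 0 < r & e = r%:C.
Proof.
case: e => er ei; rewrite (ltcE (0 : R[i])) /= => /andP[/eqP -> r0].
by exists er.
Qed.

Lemma Re_le_norm z : `|complex.Re z|%:C <= `|z|.
Proof.
rewrite (normc_def (z : R[i])) lecR -sqrtr_sqr ler_wsqrtr //.
by rewrite lerDl sqr_ge0.
Qed.

Lemma Im_le_norm z : `|complex.Im z|%:C <= `|z|.
Proof.
rewrite (normc_def (z : R[i])) lecR -sqrtr_sqr ler_wsqrtr //.
by rewrite lerDr sqr_ge0.
Qed.

Lemma norm_le_Re_Im z : `|z| <= (`|complex.Re z| + `|complex.Im z|)%:C.
Proof.
have norm_i : `|('i%C : R[i]) : C| = 1.
  by rewrite (normc_def 'i%C) /= expr0n add0r expr1n sqrtr1.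
rewrite {1}[z](complexE (z : R[i])) (le_trans (ler_normD _ _)) //.
by rewrite normrM norm_i mul1r !normCR realCD.
Qed.

Lemma Re_norm_ge0 z : 0 <= complex.Re `|z|.
Proof. by rewrite -lecR -normC_re normr_ge0. Qed.

Lemma ReD z w : complex.Re (z + w) = complex.Re z + complex.Re w.
Proof. by case: z; case: w. Qed.
Lemma ReN z : complex.Re (- z) = - complex.Re z.
Proof. by case: z. Qed.
Lemma ReMr t z : complex.Re (t%:C * z) = t * complex.Re z.
Proof. by case: z => a b /=; rewrite mul0r subr0. Qed.

Lemma near_real_scale (P : C -> Prop) v :
  (\forall h \near (0 : C), P h) -> \forall s \near (0 : R), P (s%:C * v).
Proof.
move=> /nbhs_ballP[e e0 he]; have [r r0 er] := gt0_re e0.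
(* Dividing by 1 + |v| rather than |v| covers v = 0. *)
have v1 : 0 < 1 + complex.Re `|v|.
  by rewrite ltr_wpDr // Re_norm_ge0.
apply/nbhs_ballP; exists (r / (1 + complex.Re `|v|)); first exact: divr_gt0.
move=> s; rewrite /ball /= sub0r normrN => hs; apply: he.
rewrite /ball /= sub0r normrN normrM normCR normC_re -realCM er ltcR /=.
have : `|s| * (1 + complex.Re `|v|) < r by rewrite -ltr_pdivlMr.
by apply: le_lt_trans; rewrite ler_wpM2l // lerDr.
Qed.

Lemma is_derive_Re_segment (g : C -> C) u v t d :
  is_derive (u + t%:C * v) (1 : C) g d ->
  is_derive t (1 : R) (fun s => complex.Re (g (u + s%:C * v))) (complex.Re (d * v)).
Proof.
move=> dg; apply: bound_is_derive => e e0.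
have v1 : 0 < 1 + `|v| by rewrite ltr_wpDr.
have e1 : 0 < e%:C / (1 + `|v|) by rewrite divr_gt0 // (ltcR 0).
have := near_real_scale v (is_derive_bound dg e1); apply: filterS => s.
have -> : u + t%:C * v + s%:C * v = u + (t + s)%:C * v by rewrite realCD; ring.
move=> hs; rewrite -lecR.
have -> : complex.Re (g (u + (t + s)%:C * v)) - complex.Re (g (u + t%:C * v))
    - s * complex.Re (d * v)
  = complex.Re (g (u + (t + s)%:C * v) - g (u + t%:C * v) - s%:C * v * d).
  by rewrite -mulrA [v * d]mulrC !ReD !ReN ReMr.
apply: (le_trans (Re_le_norm _)); apply: (le_trans hs).
rewrite normrM normCR realCM -mulrA ler_wpM2l //; first by rewrite (lecR 0) ltW.
rewrite mulrCA ler_piMr ?(lecR 0) //.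
by rewrite mulrC ler_pdivrMr // mul1r lerDr.
Qed.

Lemma complex_mean_value_Re (g dg : C -> C) u v (M : C) :
  (forall t, 0 <= t <= 1 -> is_derive (u + t%:C * v) (1 : C) g (dg (u + t%:C * v))) ->
  (forall t, 0 <= t <= 1 -> `|dg (u + t%:C * v)| <= M) ->
  `|complex.Re (g (u + v) - g u)|%:C <= M * `|v|.
Proof.
move=> hd hM; pose phi s := complex.Re (g (u + s%:C * v)).
have dphi t : t \in `[0, 1] ->
    is_derive t (1 : R) phi (complex.Re (dg (u + t%:C * v) * v)).
  by rewrite in_itv /= => /hd; exact: is_derive_Re_segment.
have le01 : (0 : R) <= 1 by exact: ler01.
pose dp t := complex.Re (dg (u + t%:C * v) * v).
have dphi' t : t \in `]0, 1[ -> is_derive t (1 : R) phi (dp t).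
  by move=> t01; apply: dphi; exact: subset_itv_oo_cc t01.
have cphi : {within `[0, 1], continuous phi}.
  by apply: derivable_within_continuous => t /dphi [].
have [t t01 e] := MVT_segment le01 dphi' cphi.
have -> : complex.Re (g (u + v) - g u) = phi 1 - phi 0.
  by rewrite /phi rmorph1 mul1r rmorph0 mul0r addr0 ReD ReN.
rewrite e subr0 mulr1 /dp; apply: (le_trans (Re_le_norm _)).
by rewrite normrM ler_wpM2r // hM; move: t01; rewrite in_itv.
Qed.

(** Complex values admit no mean value equality, so the real and imaginary parts are bounded
    separately, at the cost of the factor 2. *)
Lemma complex_mean_value (g dg : C -> C) u v (M : C) :
  (forall t, 0 <= t <= 1 -> is_derive (u + t%:C * v) (1 : C) g (dg (u + t%:C * v))) ->
  (forall t, 0 <= t <= 1 -> `|dg (u + t%:C * v)| <= M) ->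
  `|g (u + v) - g u| <= 2 * M * `|v|.
Proof.
move=> hd hM; apply: (le_trans (norm_le_Re_Im _)).
rewrite realCD -mulrA mulr_natl mulr2n /=; apply: lerD.
  exact: complex_mean_value_Re hd hM.
pose i : C := 'i%C : R[i].
have ni : `|- i| = 1.
  by rewrite normrN (normc_def 'i%C) /= expr0n add0r expr1n sqrtr1.
(* Im w = Re (- i w), so the bound for real parts is applied to - i g. *)
have -> : complex.Im (g (u + v) - g u) =
    complex.Re ((- i) * g (u + v) - (- i) * g u).
  by rewrite -mulrBr mulNr ReN mulrC (ReiNIm (_ : R[i])) opprK.
apply: (@complex_mean_value_Re (fun z => (- i) * g z) (fun z => (- i) * dg z)).
  move=> t /hd dt.
  by apply: (@is_deriveZ _ _ _ g (- i)).
by move=> t /hM; rewrite normrM ni mul1r.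
Qed.

End ComplexBasics.

Section ChainRule.
Variable K : numFieldType.

Lemma is_derive1_comp (f g : K -> K) (x df dg : K) :
  is_derive x (1 : K) f df -> is_derive (f x) (1 : K) g dg ->
  is_derive x (1 : K) (g \o f) (dg * df).
Proof.
move=> [f1 f2] [g1 g2].
have df1 : differentiable f x by apply/derivable1_diffP.
have dg1 : differentiable g (f x) by apply/derivable1_diffP.
have dgf : differentiable (g \o f) x by exact: differentiable_comp.
apply: DeriveDef; first exact/derivable1_diffP.
rewrite deriveE // diff_comp //= -[X in 'd g _ X]deriveE // f2.
by rewrite -[X in 'd g _ X]mulr1 linearZ /= -deriveE // g2 mulrC.
Qed.

End ChainRule.

Section ComplexExponential.
Variable R : realType.
Local Notation C := (CC R).
Local Notation "x %:C" := (real_complex R x : C).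
Implicit Types (z w : C) (x y : R).

Lemma cexpD z w : cexp (z + w) = cexp z * cexp w.
Proof.
have mulE p q r s : (Complex p q : C) * (Complex r s : C) =
  Complex (p * r - q * s) (p * s + q * r) by [].
case: z w => [a b] [c d]; rewrite /cexp /= mulE expRD cosD sinD.
by congr Complex; ring.
Qed.

Lemma cexp0 : cexp (0 : C) = 1.
Proof. by rewrite /cexp /= expR0 cos0 sin0 mulr1 mulr0. Qed.

Lemma cexp_neq0 z : cexp z != 0.
Proof.
apply/eqP => e; have := cexpD z (- z).
by rewrite subrr cexp0 e mul0r => /eqP; rewrite oner_eq0.
Qed.

Lemma near_Re_Im (P Q : R -> Prop) :
  (\forall x \near (0 : R), P x) -> (\forall y \near (0 : R), Q y) ->
  \forall z \near (0 : C), P (complex.Re z) /\ Q (complex.Im z).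
Proof.
move=> /nbhs_ballP[r r0 hr] /nbhs_ballP[s s0 hs].
apply/nbhs_ballP; exists (Num.min r s)%:C.
  by apply: gt0C; rewrite lt_min r0 s0.
move=> z; rewrite /ball /= sub0r normrN => hz.
by split; [apply: hr|apply: hs]; rewrite /ball /= sub0r normrN -ltcR;
  [apply: le_lt_trans (Re_le_norm z) _|apply: le_lt_trans (Im_le_norm z) _];
  apply: (lt_le_trans hz); rewrite lecR ge_min lexx ?orbT.
Qed.

(** The constant 6 is 1 + 2 + 3: the real part contributes e|x| + 2e|y|, the imaginary part 3e|y|,
    and both |x| and |y| are at most |z|. *)
Lemma cexp_bound0 x y (e : R) : 0 < e -> e <= 1 ->
  `|expR x - 1 - x| <= e * `|x| -> `|expR x - 1| <= e ->
  `|cos y - 1| <= e * `|y| -> `|sin y - y| <= e * `|y| ->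
  `|cexp (Complex x y : C) - 1 - (Complex x y : C)| <= (6 * e)%:C * `|Complex x y : C|.
Proof.
move=> e0 e1 hx hx1 hc hs; apply: (le_trans (norm_le_Re_Im _)).
rewrite !(ReD, ReN) /=.
set z : C := Complex x y.
have Ex2 : `|expR x| <= 2.
  have -> : expR x = (expR x - 1) + 1 by rewrite subrK.
  by rewrite (le_trans (ler_normD _ _)) // normr1; lra.
have xz : `|x|%:C <= `|z| by exact: (Re_le_norm z).
have yz : `|y|%:C <= `|z| by exact: (Im_le_norm z).
have h1 : `|expR x * cos y - 1 - x| <= e * `|x| + 2 * e * `|y|.
  have -> : expR x * cos y - 1 - x = (expR x - 1 - x) + expR x * (cos y - 1) by ring.
  rewrite (le_trans (ler_normD _ _)) // lerD // normrM -mulrA ler_pM //.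
have h2 : `|expR x * sin y - 0 - y| <= 3 * e * `|y|.
  have -> : expR x * sin y - 0 - y = expR x * (sin y - y) + (expR x - 1) * y by ring.
  rewrite (le_trans (ler_normD _ _)) // !normrM.
  have : `|expR x| * `|sin y - y| <= 2 * (e * `|y|) by rewrite ler_pM.
  have : `|expR x - 1| * `|y| <= e * `|y| by rewrite ler_wpM2r.
  lra.
apply: (@le_trans _ _ ((e * `|x| + 5 * e * `|y|)%:C)).
  by rewrite lecR; lra.
rewrite realCD !realCM.
have -> : (6%:C * e%:C : C) = e%:C + 5%:C * e%:C.
  by rewrite -!realCM -realCD; congr (_%:C); ring.
have e0' : 0 <= e%:C by rewrite ge0C ?ltW.
by rewrite mulrDl lerD // ler_wpM2l // mulr_ge0 // ge0C ?ler0n.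
Qed.

Lemma is_derive_cexp z : is_derive z (1 : C) (@cexp R) (cexp z).
Proof.
apply: bound_is_derive => e0 e00.
have cz : 0 < `|cexp z| by rewrite normr_gt0 cexp_neq0.
have [e e_gt0 ee] : exists2 e : R, 0 < e & e0 / `|cexp z| = e%:C.
  by have [e ? ?] := gt0_re (divr_gt0 e00 cz); exists e.
pose d := Num.min 1 (e / 6).
have d0 : 0 < d by rewrite lt_min ltr01 divr_gt0.
have d1 : d <= 1 by rewrite ge_min lexx.
have d6 : 6 * d <= e.
  have : d <= e / 6 by rewrite ge_min lexx orbT.
  lra.
have hE := is_derive_bound (is_derive_expR 0) d0.
have hE1 : \forall x \near (0 : R), `|expR x - 1| <= d.
  have /cvgrPdist_le /(_ d d0) := @continuous_expR R 0.
  by apply: filterS => x; rewrite expR0 distrC.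
have hc := is_derive_bound (is_derive_cos 0) d0.
have hs := is_derive_bound (is_derive_sin 0) d0.
have hx := @filterI _ _ (nbhs_filter (0 : R)) _ _ hE hE1.
have hy := @filterI _ _ (nbhs_filter (0 : R)) _ _ hc hs.
have := near_Re_Im hx hy; apply: filterS => -[x y] /= [[h1 h2] [h3 h4]].
have := @cexp_bound0 x y d d0 d1.
move: h1 h3 h4; rewrite !add0r expR0 cos0 sin0 !mulr1 oppr0 mulr0 !subr0 addr0.
move=> h1 h3 h4 /(_ h1 h2 h3 h4) h.
rewrite cexpD.
have -> : cexp z * cexp (Complex x y : C) - cexp z - (Complex x y : C) * cexp z
  = cexp z * (cexp (Complex x y : C) - 1 - (Complex x y : C)) by ring.
rewrite normrM -(divfK (lt0r_neq0 cz) e0) ee [X in _ <= X * _]mulrC -mulrA.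
rewrite ler_wpM2l // (le_trans h) // ler_wpM2r // lecR.
by [].
Qed.

End ComplexExponential.

(** * Local Taylor expansions of a branch *)

Section LocalBounds.
Variable K : numFieldType.

Lemma locally_bounded (V W : normedModType K) (g : V -> W) (z : V) :
  {for z, continuous g} ->
  exists2 M : K, 0 <= M & \forall x \near z, `|g x| <= M.
Proof.
move=> /cvgrPdist_le /(_ 1 ltr01) h; exists (`|g z| + 1); first by rewrite addr_ge0.
move: h; apply: filterS => x h.
rewrite -[g x](subrK (g z)) addrC (le_trans (ler_normD _ _)) // lerD2l.
by rewrite distrC.
Qed.

Lemma is_derive_continuous (g : K -> K) z d :
  is_derive z (1 : K) g d -> {for z, continuous g}.
Proof.
by move=> [dg _]; apply: differentiable_continuous; apply/derivable1_diffP.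
Qed.

Lemma is_derive_horner (p : {poly K}) (x : K) :
  is_derive x (1 : K) (horner p) p^`().[x].
Proof.
elim/poly_ind: p => [|p c IH].
  rewrite deriv0 horner0.
  have -> : horner (0 : {poly K}) = cst 0 by apply/funext => y; rewrite horner0.
  exact: is_derive_cst.
have -> : horner (p * 'X + c%:P) = (horner p * id) + cst c.
  by apply/funext => y; rewrite !hornerE.
apply: is_derive_eq.
rewrite derivD derivM derivX derivC addr0 !hornerE.
by rewrite /GRing.scale /=; ring.
Qed.

(** A quadratic error is o(|q - p|), so g has the same differential at p as g1. On the diagonal this
    does the work of a removable singularity theorem. *)
Lemma differentiable_add_small (V W : normedModType K) (g g1 : V -> W) (p : V) (M : K) :
  0 <= M -> differentiable g1 p ->
  (\forall q \near p, `|g q - g1 q| <= M * `|q - p| ^+ 2) ->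
  differentiable g p.
Proof.
move=> M0 dg1 hM.
have gp : g p = g1 p.
  apply/eqP; rewrite -subr_eq0 -normr_le0.
  by have := nbhs_singleton hM; rewrite subrr normr0 expr0n mulr0.
have e1 : g \o shift p = cst (g p) + 'd g1 p +o_ (0 : V) id.
  apply/eqaddoP => e e0.
  have /eqaddoP/(_ (e / 2)) := diff_locally dg1.
  have e20 : 0 < e / 2 by rewrite divr_gt0.
  move=> /(_ e20) h1.
  have h2 : \forall h \near (0 : V), `|g (h + p) - g1 (h + p)| <= M * `|h| ^+ 2.
    have := hM; rewrite (near_shift 0 p) /=; apply: filterS => h /=.
    by rewrite subr0 addrK.
  have h3 : \forall h \near (0 : V), M * `|h| <= e / 2.
    have M1 : 0 < M + 1 by rewrite ltr_wpDl.
    have r0 : 0 < e / 2 / (M + 1) by rewrite divr_gt0.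
    apply/nbhs_ballP; exists (e / 2 / (M + 1)) => // h.
    rewrite -ball_normE /= sub0r normrN ltr_pdivlMr // => /ltW.
    apply: le_trans; rewrite mulrC ler_wpM2l // lerDl //.
  near=> h.
  have k1 : `|(g1 \o shift p - (cst (g1 p) + 'd g1 p)) h| <= e / 2 * `|h|.
    by near: h.
  have k2 : `|g (h + p) - g1 (h + p)| <= M * `|h| ^+ 2 by near: h.
  have k3 : M * `|h| <= e / 2 by near: h.
  have -> : (g \o shift p - (cst (g p) + 'd g1 p)) h =
     (g (h + p) - g1 (h + p)) + (g1 \o shift p - (cst (g1 p) + 'd g1 p)) h.
    by rewrite gp !fctE /= addrA subrK.
  rewrite (le_trans (ler_normD _ _)) // [e in e * _](splitr e) mulrDl lerD //.
  by apply: (le_trans k2); rewrite expr2 mulrA ler_wpM2r.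
have dE : 'd g p = 'd g1 p :> (V -> W).
  by apply: diff_unique e1; exact: diff_continuous.
apply/diff_locallyP; rewrite dE; split; first exact: diff_continuous.
exact: e1.
Unshelve. all: by end_near. Qed.

End LocalBounds.

Section BigOh.
Variable K : numFieldType.
Implicit Types (z : K) (A B : K * K -> K) (n : nat).

(* Locally uniform [O(|x - u|^n)] at the diagonal point [(z, z)], for pairs [p = (u, x)]. *)
Definition diag_bigO z n A B := exists2 M : K, 0 <= M &
  \forall p \near (z, z), `|A p - B p| <= M * `|p.2 - p.1| ^+ n.

Definition diag_bounded z A := exists2 M : K, 0 <= M & \forall p \near (z, z), `|A p| <= M.

Lemma near_fst z (P : K -> Prop) :
  (\forall x \near z, P x) -> \forall p \near (z, z), P p.1.
Proof. by move=> h; apply: (@cvg_fst _ _ (nbhs z) (nbhs z)); exact: h. Qed.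

Lemma near_snd z (P : K -> Prop) :
  (\forall x \near z, P x) -> \forall p \near (z, z), P p.2.
Proof. by move=> h; apply: (@cvg_snd _ _ (nbhs z) (nbhs z)); exact: h. Qed.

Lemma near_diag_dist z : \forall p \near (z, z), `|p.2 - p.1| <= 1.
Proof.
have : {for (z, z), continuous (fun p : K * K => p.2 - p.1)}.
  by apply: continuousB; [exact: cvg_snd|exact: cvg_fst].
move=> /cvgrPdist_le /(_ 1 ltr01); apply: filterS => p /=.
by rewrite subrr sub0r normrN.
Qed.

Lemma diag_bounded_diag_bigO z n A B : diag_bounded z A -> diag_bigO z n A B -> diag_bounded z B.
Proof.
move=> [M1 M10 h1] [M2 M20 h2]; exists (M1 + M2); first exact: addr_ge0.
have h3 := near_diag_dist z; near=> p.
have -> : B p = A p - (A p - B p) by rewrite subKr.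
rewrite (le_trans (ler_normB _ _)) // lerD //; first by near: p.
have k2 : `|A p - B p| <= M2 * `|p.2 - p.1| ^+ n by near: p.
have k3 : `|p.2 - p.1| <= 1 by near: p.
by rewrite (le_trans k2) // ler_piMr // exprn_ile1.
Unshelve. all: by end_near. Qed.

Lemma diag_boundedM z A B : diag_bounded z A -> diag_bounded z B -> diag_bounded z (fun p => A p * B p).
Proof.
move=> [M1 M10 h1] [M2 M20 h2]; exists (M1 * M2); first exact: mulr_ge0.
by near=> p; rewrite normrM ler_pM //; near: p.
Unshelve. all: by end_near. Qed.

Lemma diag_bigOM z n A B A' B' : diag_bounded z A -> diag_bounded z A' ->
  diag_bigO z n A B -> diag_bigO z n A' B' ->
  diag_bigO z n (fun p => A p * A' p) (fun p => B p * B' p).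
Proof.
move=> bA bA' hA hA'; have [M2 M20 h2] := diag_bounded_diag_bigO bA hA.
have [M1 M10 h1] := bA'; have [N1 N10 k1] := hA; have [N2 N20 k2] := hA'.
exists (N1 * M1 + M2 * N2); first by rewrite addr_ge0 // mulr_ge0.
near=> p.
have -> : A p * A' p - B p * B' p = (A p - B p) * A' p + B p * (A' p - B' p) by ring.
rewrite (le_trans (ler_normD _ _)) // [X in _ <= X]mulrDl lerD // normrM.
  by rewrite mulrAC ler_pM //; near: p.
by rewrite -mulrA ler_pM //; near: p.
Unshelve. all: by end_near. Qed.

Lemma diag_bounded_snd z (g : K -> K) : {for z, continuous g} -> diag_bounded z (fun p => g p.2).
Proof.
move=> /locally_bounded[M M0 hM]; exists M => //.
exact: near_snd hM.
Qed.

Lemma diag_bigO_prod (I : finType) z n (A B : I -> K * K -> K) :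
  (forall i, diag_bounded z (A i)) -> (forall i, diag_bigO z n (A i) (B i)) ->
  diag_bigO z n (fun p => \prod_i A i p) (fun p => \prod_i B i p).
Proof.
move=> bA hA.
suff [] : diag_bounded z (fun p => \prod_i A i p) /\
   diag_bigO z n (fun p => \prod_i A i p) (fun p => \prod_i B i p) by [].
elim: (index_enum I) => [|i r [IH1 IH2]].
  split; [exists 1|exists 0] => //; near=> p; rewrite !big_nil ?normr1 //.
  by rewrite subrr normr0 mul0r.
have e1 : (fun p => \prod_(j <- i :: r) A j p) =
    (fun p => A i p * \prod_(j <- r) A j p).
  by apply/funext => p; rewrite big_cons.
have e2 : (fun p => \prod_(j <- i :: r) B j p) =
    (fun p => B i p * \prod_(j <- r) B j p).
  by apply/funext => p; rewrite big_cons.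
by rewrite e1 e2; split; [exact: diag_boundedM|exact: diag_bigOM].
Unshelve. all: by end_near. Qed.

End BigOh.

Section Taylor.
Variable R : realType.
Local Notation C := (CC R).
Local Notation "x %:C" := (real_complex R x : C).

(** A local logarithm is known only through exp (L x) = x - a; differentiating this relation gives
    its derivative. *)
Lemma is_derive_log (V : set C) (L : C -> C) (a : C) :
  open V -> holomorphic_on V L -> (forall x, V x -> cexp (L x) = x - a) ->
  forall x, V x -> is_derive x (1 : C) L (x - a)^-1.
Proof.
move=> oV hL cL x Vx.
have xa : x - a != 0 by rewrite -cL // cexp_neq0.
have [dL eL] : is_derive x (1 : C) L ('D_1 L x) by apply: derivableP; exact: hL.
apply: DeriveDef => //.
have h1 := is_derive1_comp (DeriveDef dL erefl) (is_derive_cexp (L x)).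
have h2 : is_derive x (1 : C) (@cexp R \o L) 1.
  apply: (@near_eq_is_derive _ _ _ (id - cst a)).
    by near=> y; rewrite /= cL //; near: y; exact: open_nbhs_nbhs.
  by apply: is_derive_eq; rewrite subr0.
have : cexp (L x) * 'D_1 L x = 1.
  by rewrite -(@derive_val _ _ _ _ _ _ _ h1) (@derive_val _ _ _ _ _ _ _ h2).
by rewrite cL // => e; apply: (mulfI xa); rewrite e divff.
Unshelve. all: by end_near. Qed.

Lemma is_derive_cpow (V : set C) (L : C -> C) (a b : C) :
  open V -> holomorphic_on V L -> (forall x, V x -> cexp (L x) = x - a) ->
  forall x, V x ->
  is_derive x (1 : C) (fun y => cexp (b * L y)) (cexp (b * L x) * (b / (x - a))).
Proof.
move=> oV hL cL x Vx; have dL := is_derive_log oV hL cL Vx.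
have dbL : is_derive x (1 : C) (fun y => b * L y) (b / (x - a)).
  exact: (@is_deriveZ _ _ _ L b).
exact: (is_derive1_comp dbL (is_derive_cexp (b * L x))).
Qed.

(* By [binser_ode], the derivative of [(x - a)^(-b)] times the truncated series is
   [(x - a)^(-b-1)] times a constant times [((x - u) / (u - a))^N]; the mean value
   inequality on the segment from [u] to [x] then gains the last power of [x - u]. *)
Lemma cpow_taylor N (V : set C) (L : C -> C) (a b z : C) :
  open V -> V z -> holomorphic_on V L -> (forall x, V x -> cexp (L x) = x - a) ->
  diag_bigO z N.+1 (fun p => cexp (b * L p.2))
    (fun p => cexp (b * L p.1) * (tser N a b p.1).[p.2 - p.1]).
Proof.
move=> oV Vz hL cL.
have dl b' := is_derive_cpow b' oV hL cL.
have za : z - a != 0 by rewrite -cL // cexp_neq0.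
have cV : {for z, continuous (fun x : C => (x - a)^-1)}.
  apply: (@continuousV _ _ (fun x : C => x - a)) => //.
  apply: (@continuousB _ _ _ id (cst a)); [exact: cvg_id|exact: cst_continuous].
have [M1 M10 hM1] : exists2 M, 0 <= M &
    \forall x \near z, `|cexp (- b * L x) / (x - a)| <= M.
  apply: locally_bounded; apply: continuousM cV.
  exact: is_derive_continuous (dl (- b) z Vz).
have [M2 M20 hM2] := locally_bounded cV.
have [M3 M30 hM3] : exists2 M, 0 <= M & \forall x \near z, `|cexp (b * L x)| <= M.
  by apply: locally_bounded; exact: is_derive_continuous (dl b z Vz).
have hV : \forall x \near z, V x by apply: open_nbhs_nbhs.
pose c := (N%:R - b) * gbinom b N.
have := @filterI _ _ (nbhs_filter z) _ _ (@filterI _ _ (nbhs_filter z) _ _ hM1 hM2)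
  (@filterI _ _ (nbhs_filter z) _ _ hM3 hV).
move=> /nbhs_ballP[r r0 hr].
(* [M3] bounds the powers at x and at u, the 2 comes from [complex_mean_value], and the rest comes
   from the bound on [dk] along the segment. *)
exists (M3 * M3 * (2 * (M1 * (`|c| * M2 ^+ N)))).
  by rewrite !mulr_ge0 // exprn_ge0.
have hb : \forall x \near z, ball z r x by exact: nbhsx_ballx.
have := @filterI _ _ (nbhs_filter (z, z)) _ _ (near_fst hb) (near_snd hb).
apply: filterS => -[u x] /= [bu bx].
set B := binser N.+1 b; set s := u - a.
have [[_ _] [h3u Vu]] := hr u bu.
have [[_ _] [h3x Vx]] := hr x bx.
have s0 : s != 0 by rewrite /s -cL // cexp_neq0.
have h2u : `|s^-1| <= M2 by have [[]] := hr u bu.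
pose E y := cexp (- b * L y).
have EK y : E y * cexp (b * L y) = 1 by rewrite -cexpD mulNr addNr cexp0.
(* With the full series in place of [B], this would be the constant (u - a)^(-b); its variation thus
   measures the remainder. *)
pose k y := E y * B.[(y - u) / s].
pose dk y := E y / (y - a) * (c * ((y - u) / s) ^+ N).
have dkP y : V y -> is_derive y (1 : C) k (dk y).
  move=> Vy; have ya : y - a != 0 by rewrite -cL // cexp_neq0.
  have dw : is_derive y (1 : C) (fun y => (y - u) / s) s^-1.
    have -> : (fun y : C => (y - u) / s) = s^-1 *: (id - cst u).
      by apply/funext => t; rewrite mulrC.
    by apply: is_derive_eq; rewrite subr0 /GRing.scale /= mulr1.
  have dB := is_derive1_comp dw (is_derive_horner B ((y - u) / s)).
  have kM : is_derive y (1 : C) k _ := is_deriveM (dl (- b) y Vy) dB.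
  apply: (is_derive_eq kM); rewrite /dk -/(E y) /GRing.scale /=.
  have ode w : (1 + w) * B^`().[w] - b * B.[w] = c * w ^+ N.
    have := congr1 (horner^~ w) (binser_ode N b).
    by rewrite !(hornerD, hornerN, hornerM, hornerZ, hornerXn, hornerX, hornerC).
  rewrite -ode.
  have -> : 1 + (y - u) / s = (y - a) / s by rewrite /s; field.
  move: (E y) (B.[_]) (B^`().[_]) => ey by' b'y.
  by field; rewrite ya s0.
have seg t : 0 <= t <= 1 -> ball z r (u + t%:C * (x - u)).
  move=> /andP[t0 t1]; move: bu bx; rewrite -ball_normE /= => bu bx.
  have -> : z - (u + t%:C * (x - u)) = (1 - t)%:C * (z - u) + t%:C * (z - x).
    by rewrite realCD (rmorphN (real_complex R)); ring.
  rewrite (le_lt_trans (ler_normD _ _)) // !normrM !normCR.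
  have t1' : 0 <= 1 - t by rewrite subr_ge0.
  rewrite (ger0_norm t1') (ger0_norm t0).
  have [->|t0'] := eqVneq t 0.
    by rewrite subr0 mul1r mul0r addr0.
  have -> : r = (1 - t)%:C * r + t%:C * r by rewrite -mulrDl -realCD subrK mul1r.
  rewrite ler_ltD // ?ler_wpM2l ?ge0C ?subr_ge0 ?(ltW bu) //.
  by rewrite ltr_pM2l ?gt0C // lt_def t0'.
have := @complex_mean_value R k dk u (x - u) (M1 * (`|c| * (M2 * `|x - u|) ^+ N)).
have -> : u + (x - u) = x by rewrite addrC subrK.
have -> : k u = E u by rewrite /k subrr mul0r horner_coef0 binser0 mulr1.
move=> /(_ (fun t ht => dkP _ (proj2 (proj2 (hr _ (seg t ht)))))) mv.
have {mv} : `|k x - E u| <= 2 * (M1 * (`|c| * (M2 * `|x - u|) ^+ N)) * `|x - u|.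
  apply: mv => t ht; have [[h1t _] _] := hr _ (seg t ht).
  rewrite /dk normrM ler_pM // normrM ler_wpM2l // normrX lerXn2r ?nnegrE ?mulr_ge0 //.
  have -> : u + t%:C * (x - u) - u = t%:C * (x - u) by rewrite addrC addKr.
  rewrite normrM mulrC ler_pM // normrM normCR -[X in _ <= X]mul1r ler_wpM2r //.
  by case/andP: ht => t0 t1; rewrite ger0_norm // (lecR _ 1).
move=> mv.
have -> : cexp (b * L x) - cexp (b * L u) * (tser N a b u).[x - u] =
   - (cexp (b * L x) * cexp (b * L u) * (k x - E u)).
  rewrite /k /tser horner_comp hornerZ hornerX -/B -/s [s^-1 * _]mulrC.
  have := EK u; have := EK x.
  move: (E u) (E x) (cexp (b * L u)) (cexp (b * L x)) (B.[_]) => eu ex lu lx w ex1 eu1.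
  have -> : - (lx * lu * (ex * w - eu)) = (eu * lu) * lx - (ex * lx) * (lu * w) by ring.
  by rewrite ex1 eu1 !mul1r.
have -> : M3 * M3 * (2 * (M1 * (`|c| * M2 ^+ N))) * `|x - u| ^+ N.+1 =
    M3 * M3 * (2 * (M1 * (`|c| * (M2 * `|x - u|) ^+ N)) * `|x - u|).
  by rewrite exprMn exprSr; ring.
rewrite normrN normrM normrM; apply: ler_pM => //.
exact: ler_pM.
Qed.

End Taylor.

Section RegularFamilies.
Variable K : numFieldType.
Implicit Types (z u v x y : K) (P Q : K -> {poly K}).

(** Polynomials in v that depend on a base point u. The common size bound turns local bounds on
    coefficients into local bounds on values. *)
Definition regular_family z P :=
  (exists n, forall u, (size (P u) <= n)%N) /\
  forall j, differentiable (fun u => (P u)`_j) z.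

Lemma differentiable_sumf (V : normedModType K) n (g : 'I_n -> V -> K) (p : V) :
  (forall i, differentiable (g i) p) -> differentiable (fun q => \sum_i g i q) p.
Proof.
move=> h; have -> : (fun q => \sum_i g i q) = \sum_i g i.
  by apply/funext => q; rewrite fct_sumE.
exact: differentiable_sum.
Qed.

Lemma differentiable_expf (V : normedModType K) (g : V -> K) n (p : V) :
  differentiable g p -> differentiable (fun q => g q ^+ n) p.
Proof.
have -> : (fun q => g q ^+ n) = g ^+ n by apply/funext => q; rewrite exprfctE.
case: n => [|n]; first by rewrite expr0 => _; exact: (differentiable_cst (1 : K)).
exact: differentiableX.
Qed.

Lemma regular_familyM z P Q : regular_family z P -> regular_family z Q ->
  regular_family z (fun u => P u * Q u).
Proof.
move=> [[n sP] dP] [[m sQ] dQ]; split.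
  exists (n + m)%N => u; rewrite (leq_trans (size_polyMleq _ _)) //.
  by rewrite (leq_trans (leq_pred _)) // leq_add.
move=> j; have -> : (fun u => (P u * Q u)`_j) =
    (fun u => \sum_(i < j.+1) (P u)`_i * (Q u)`_(j - i)).
  by apply/funext => u; rewrite coefM.
by apply: differentiable_sumf => i; exact: differentiableM.
Qed.

Lemma regular_family_prod (I : finType) z (P : I -> K -> {poly K}) :
  (forall i, regular_family z (P i)) ->
  regular_family z (fun u => \prod_i P i u).
Proof.
move=> h; elim: (index_enum I) => [|i r IH].
  have -> : (fun u => \prod_(i <- [::]) P i u) = cst 1.
    by apply/funext => u; rewrite big_nil.
  by split=> [|j]; [exists 1%N => u; rewrite size_poly1|exact: (differentiable_cst ((1 : {poly K})`_j))].
have -> : (fun u => \prod_(j <- i :: r) P j u) =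
    (fun u => P i u * \prod_(j <- r) P j u).
  by apply/funext => u; rewrite big_cons.
exact: regular_familyM.
Qed.

Lemma regular_tser N a b z : z != a -> regular_family z (tser N a b).
Proof.
move=> za; split.
  exists N.+1 => u; apply/leq_sizeP => j Nj.
  by rewrite coef_comp_scaleX coef_poly ltnNge Nj mulr0.
move=> j; have -> : (fun u => (tser N a b u)`_j) =
    (fun u => (fun u => (u - a)^-1) u ^+ j * cst ((binser N.+1 b)`_j) u).
  by apply/funext => u; rewrite coef_comp_scaleX.
apply: differentiableM => //; apply: differentiable_expf.
apply: differentiableV; last by rewrite subr_eq0.
exact: (@differentiableB _ _ _ id (cst a)).
Qed.

Lemma regular_ateval z (G : {poly {poly K}}) :
  regular_family z (fun u => ateval u G).
Proof.
split; first by exists (size G) => u; exact: size_poly.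
move=> j; have -> : (fun u => (ateval u G)`_j) = horner G`_j.
  by apply/funext => u; rewrite coef_ateval.
by apply/derivable1_diffP; have [] := is_derive_horner G`_j z.
Qed.

Lemma regular_bounded z P : regular_family z P ->
  exists2 M, 0 <= M & \forall u \near z, forall v, `|v| <= 1 -> `|(P u).[v]| <= M.
Proof.
move=> [[n sP] dP].
have hj j : exists2 M, 0 <= M & \forall u \near z, `|(P u)`_j| <= M.
  by apply: locally_bounded; exact: differentiable_continuous.
have [M M0 hM] : exists2 M, 0 <= M &
    \forall u \near z, \sum_(j < n) `|(P u)`_j| <= M.
  elim: n {sP} => [|n [M M0 hM]].
    by exists 0 => //; near=> u; rewrite big_ord0.
  have [M' M'0 hM'] := hj n; exists (M + M'); first exact: addr_ge0.
  by near=> u; rewrite big_ord_recr /= lerD //; near: u.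
exists M => //; move: hM; apply: filterS => u hu v v1.
rewrite (horner_coef_wide _ (sP u)) (le_trans (ler_norm_sum _ _ _)) //.
apply: le_trans hu; apply: ler_sum => j _.
by rewrite normrM normrX ler_piMr // exprn_ile1.
Unshelve. all: by end_near. Qed.

Lemma differentiable_fst (p : K * K) : differentiable (@fst K K) p.
Proof.
apply: (@linear_differentiable K _ _ (fst : {linear (K * K)%type -> K})).
by move=> q; exact: cvg_fst.
Qed.

Lemma differentiable_snd (p : K * K) : differentiable (@snd K K) p.
Proof.
apply: (@linear_differentiable K _ _ (snd : {linear (K * K)%type -> K})).
by move=> q; exact: cvg_snd.
Qed.

Lemma differentiable_horner2 (F : {poly {poly K}}) (p : K * K) :
  differentiable (fun q : K * K => F.[q.1, q.2]) p.
Proof.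
have -> : (fun q : K * K => F.[q.1, q.2]) =
    (fun q => \sum_(i < size F) (horner F`_i \o snd) q * (fst q) ^+ i).
  by apply/funext => q; rewrite horner2E.
apply: differentiable_sumf => i.
have d1 := differentiable_fst p; have d2 := differentiable_snd p.
apply: (@differentiableM _ _ (horner F`_i \o snd) (fun q : K * K => q.1 ^+ i)).
  apply: differentiable_comp => //.
  by apply/derivable1_diffP; have [] := is_derive_horner F`_i p.2.
exact: differentiable_expf.
Qed.

End RegularFamilies.

Lemma norm_mulB_le (K : numDomainType) (x1 x2 y1 y2 M M1 w : K) :
  `|x1| <= M * w -> `|x2| <= M * w -> `|y1| <= M1 -> `|y2| <= M1 ->
  `|x1 * y1 - x2 * y2| <= (M * M1 + M * M1) * w.
Proof.
move=> h1 h2 h3 h4; rewrite (le_trans (ler_normB _ _)) //.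
by rewrite mulrDl lerD // normrM mulrAC ler_pM.
Qed.

Definition midpoint (K : numFieldType) (p : K * K) : K := 2^-1 * (p.1 + p.2).
Definition half_diff (K : numFieldType) (p : K * K) : K := 2^-1 * (p.1 - p.2).

(** * Expansion of the numerator at the midpoint *)

Section Numerator.
Variable R : realType.
Local Notation C := (CC R).
Variables (k : nat) (a b : 'I_k -> C) (U : set C) (f : C -> C).
Hypotheses (oU : open U) (fbr : is_branch a b U f).

Lemma branch_taylor N z : U z ->
  diag_bigO z N.+1 (fun p => f p.2) (fun p => f p.1 * (tsers N a b p.1).[p.2 - p.1]).
Proof.
move=> Uz; have [_ /(_ z Uz) [V [L [[oV Vz VU] [hL cL fL]]]]] := fbr.
have bl i : diag_bounded z (fun p : C * C => cexp (b i * L i p.2)).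
  apply: diag_bounded_snd (fun y => cexp (b i * L i y)) _.
  exact: is_derive_continuous (is_derive_cpow (b i) oV (hL i) (cL i) Vz).
have [M M0 hM] := diag_bigO_prod bl
  (fun i => cpow_taylor N (b i) oV Vz (hL i) (cL i)).
exists M => //.
have cexp_sum (c : 'I_k -> C) : cexp (\sum_i c i) = \prod_i cexp (c i).
  by elim/big_rec2: _ => [|i s t _ <-]; [exact: cexp0|rewrite cexpD].
have hV : \forall x \near z, V x by apply: open_nbhs_nbhs.
have h1 := near_fst hV; have h2 := near_snd hV.
near=> p; have V1 : V p.1 by near: p.
have V2 : V p.2 by near: p.
rewrite !fL // !cexp_sum /tsers horner_prod -big_split /=.
by near: p.
Unshelve. all: by end_near. Qed.

Lemma branch_neq0 z : U z -> f z != 0.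
Proof.
move=> Uz; have [_ /(_ z Uz) [V [L [[_ Vz _] [_ _ fL]]]]] := fbr.
by rewrite fL // cexp_neq0.
Qed.

Lemma branch_avoids z i : U z -> z != a i.
Proof.
move=> Uz; have [_ /(_ z Uz) [V [L [[_ Vz _] [_ cL _]]]]] := fbr.
by rewrite -subr_eq0 -cL // cexp_neq0.
Qed.

Lemma branch_differentiable z : U z -> differentiable f z.
Proof. by move=> Uz; apply/derivable1_diffP; have [h _] := fbr; exact: h. Qed.

Variable F : {poly {poly C}}.
Let num (p : C * C) := f p.1 * F.[p.1, p.2] - f p.2 * F.[p.2, p.1].
Let G := to_uv F.

Lemma midpointD (p : C * C) : midpoint p + half_diff p = p.1.
Proof. by rewrite /midpoint /half_diff; field. Qed.

Lemma midpointB (p : C * C) : midpoint p - half_diff p = p.2.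
Proof. by rewrite /midpoint /half_diff; field. Qed.

Lemma horner2_midpoint p : F.[p.1, p.2] = (ateval (midpoint p) G).[half_diff p].
Proof. by rewrite -horner2_ateval horner2_to_uv midpointD midpointB. Qed.

Lemma horner2_midpointN p : F.[p.2, p.1] = (ateval (midpoint p) G).[- half_diff p].
Proof. by rewrite -horner2_ateval horner2_to_uv opprK midpointD midpointB. Qed.

Lemma differentiable_midpoint (p : C * C) : differentiable (@midpoint C) p.
Proof.
have -> : @midpoint C = 2^-1 *: (fst + snd) by apply/funext.
by apply: differentiableZ; apply: differentiableD;
  [exact: differentiable_fst|exact: differentiable_snd].
Qed.

Lemma midpoint_diag (z : C) : midpoint (z, z) = z.
Proof. by rewrite /midpoint /=; field. Qed.

Lemma near_midpoint (z : C) (P : C -> Prop) :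
  (\forall x \near z, P x) -> \forall p \near (z, z), P (midpoint p).
Proof.
move=> h; have := differentiable_continuous (differentiable_midpoint (z, z)).
by apply; rewrite midpoint_diag.
Qed.

Lemma near_midpoint_pair (z : C) (P : C * C -> Prop) : (\forall p \near (z, z), P p) ->
  (\forall p \near (z, z), P (midpoint p, p.1)) /\
  (\forall p \near (z, z), P (midpoint p, p.2)).
Proof.
move=> h; have c : @midpoint C @ nbhs (z, z) --> z.
  by rewrite -[X in _ --> X]midpoint_diag; exact: differentiable_continuous (differentiable_midpoint _).
by split; [apply: (cvg_pair c cvg_fst)|apply: (cvg_pair c cvg_snd)].
Qed.

Definition taylor_cut N u := tsers N a b u * ateval u G.

(** Both values of f are expanded at the midpoint u, where x - u = v and y - u = - v; this makes the
    main term odd in v. *)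
Lemma num_taylor N z : U z ->
  exists2 M : C, 0 <= M & \forall p \near (z, z),
   `|num p - f (midpoint p) * ((taylor_cut N (midpoint p)).[half_diff p] - (taylor_cut N (midpoint p)).[- half_diff p])|
     <= M * `|half_diff p| ^+ N.+1.
Proof.
move=> Uz; have [M M0 hM] := branch_taylor N Uz.
have /= [h1 h2] := near_midpoint_pair hM.
have [M1 M10 hM1] := locally_bounded (differentiable_continuous
  (differentiable_horner2 F (z, z))).
pose sw (p : C * C) := (p.2, p.1).
have csw : {for (z, z), continuous sw} by exact: (cvg_pair cvg_snd cvg_fst).
have hM2 : \forall p \near (z, z), `|F.[p.2, p.1]| <= M1 by exact: csw hM1.
exists (M * M1 + M * M1); first by rewrite addr_ge0 // mulr_ge0.
have ff := nbhs_filter ((z, z) : C * C).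
have := @filterI _ _ ff _ _ (@filterI _ _ ff _ _ h1 h2) (@filterI _ _ ff _ _ hM1 hM2).
apply: filterS => p [[k1 k2] [k3 k4]].
have e1 : p.1 - midpoint p = half_diff p by rewrite -{1}(midpointD p) addrC addKr.
have e2 : p.2 - midpoint p = - half_diff p by rewrite -{1}(midpointB p) addrC addKr.
rewrite e1 in k1; rewrite e2 normrN in k2.
have -> : num p - f (midpoint p) * ((taylor_cut N (midpoint p)).[half_diff p] - (taylor_cut N (midpoint p)).[- half_diff p]) =
  (f p.1 - f (midpoint p) * (tsers N a b (midpoint p)).[half_diff p]) * F.[p.1, p.2]
  - (f p.2 - f (midpoint p) * (tsers N a b (midpoint p)).[- half_diff p]) * F.[p.2, p.1].
  rewrite /taylor_cut !hornerM -horner2_midpoint -horner2_midpointN /num.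
  by move: (f _) (f _) (f _) (_.[_]) (_.[_]) (_.[_]) (_.[_]) => *; ring.
exact: norm_mulB_le k1 k2 k3 k4.
Qed.

Lemma regular_taylor_cut N z : U z -> regular_family z (taylor_cut N).
Proof.
move=> Uz; apply: regular_familyM; last exact: regular_ateval.
by apply: regular_family_prod => i; apply: regular_tser; exact: branch_avoids.
Qed.

End Numerator.

(** * Analytic and algebraic quasi-invariance *)

Lemma norm_subM_le (K : numDomainType) (h e v c M M1 : K) n :
  `|v| <= 1 -> 0 <= M -> 0 <= c -> `|h| <= M1 -> `|e| <= M * `|v| ^+ (n + 2) ->
  `|h * (c * v ^+ n) - e| <= (M1 * c + M) * `|v| ^+ n.
Proof.
move=> v1 M0 c0 hM eM; rewrite (le_trans (ler_normB _ _)) // mulrDl lerD //.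
  by rewrite !normrM (ger0_norm c0) normrX -mulrA ler_wpM2r // mulr_ge0 ?exprn_ge0.
rewrite (le_trans eM) // ler_wpM2l // exprD ler_piMr ?exprn_ge0 //.
by rewrite exprn_ile1.
Qed.

(** Here c2 v^n stands for (x - y)^n and w for the distance to a diagonal point; the two powers of v
    that survive the division make the error quadratic in w. *)
Lemma norm_quotient_le (K : numFieldType) (A fu Q c s v c2 w M M2 M3 : K) n :
  v != 0 -> Q = 2 * c * v ^+ n + s * v ^+ (n + 2) ->
  `|A - fu * Q| <= M * `|v| ^+ (n + 2) -> `|s| <= M2 -> `|fu| <= M3 ->
  1 <= c2 -> `|v| <= w ->
  `|A / (c2 * v ^+ n) - fu * (2 / c2 * c)| <= (M + M3 * M2) * w ^+ 2.
Proof.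
move=> v0 -> hA hs hf c1 vw.
have c20 : 0 < c2 by rewrite (lt_le_trans ltr01).
have vn : v ^+ n != 0 by rewrite expf_neq0.
set Q' := 2 * c * v ^+ n + s * v ^+ (n + 2) in hA.
have -> : A / (c2 * v ^+ n) - fu * (2 / c2 * c) =
    ((A - fu * Q') + fu * s * v ^+ (n + 2)) / (c2 * v ^+ n).
  by rewrite /Q' exprD; field; rewrite vn lt0r_neq0.
have v_n : 0 < `|v| ^+ n by rewrite exprn_gt0 ?normr_gt0.
have h1 : `|A - fu * Q' + fu * s * v ^+ (n + 2)| <= (M + M3 * M2) * `|v| ^+ (n + 2).
  rewrite (le_trans (ler_normD _ _)) // mulrDl lerD // !normrM normrX.
  by rewrite ler_wpM2r ?exprn_ge0 // ler_pM.
have MM : 0 <= M + M3 * M2.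
  have : 0 <= (M + M3 * M2) * `|v| ^+ (n + 2) by exact: le_trans h1.
  by rewrite pmulr_lge0 // exprn_gt0 ?normr_gt0.
rewrite normrM normfV ler_pdivrMr ?normr_gt0 ?mulf_neq0 ?(lt0r_neq0 c20) //.
apply: (le_trans h1); rewrite exprD normrM normrX (ger0_norm (ltW c20)).
have -> : (M + M3 * M2) * w ^+ 2 * (c2 * `|v| ^+ n) =
  (M + M3 * M2) * (`|v| ^+ n * (w ^+ 2 * c2)) by ring.
apply: ler_wpM2l => //; apply: ler_wpM2l; first exact: ltW.
have w0 : 0 <= w by exact: le_trans vw.
apply: (@le_trans _ _ (w ^+ 2)); first by rewrite lerXn2r ?nnegrE.
by rewrite ler_peMr // exprn_ge0.
Qed.

Lemma normr_le_double (K : numDomainType) (v : K) : `|v| <= `|2 * v|.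
Proof. by rewrite normrM (ger0_norm (ler0n _ 2)) mulr_natl mulr2n lerDl. Qed.

Lemma pair_dist_le (K : numFieldType) (q : K * K) (x : K) :
  `|half_diff q| <= `|q - (x, x)|.
Proof.
have h1 : `|q.1 - x| <= `|q - (x, x)|.
  by rewrite prod_normE /= comparable_le_max ?lexx //; apply: real_comparable.
have h2 : `|q.2 - x| <= `|q - (x, x)|.
  by rewrite prod_normE /= comparable_le_max ?lexx ?orbT //; apply: real_comparable.
have -> : half_diff q = 2^-1 * ((q.1 - x) - (q.2 - x)) by rewrite /half_diff; ring.
rewrite normrM ger0_norm ?invr_ge0 // mulrC ler_pdivrMr // mulr_natr mulr2n.
by rewrite (le_trans (ler_normB _ _)) // lerD.
Qed.

Section OddPart.
Variable K : numFieldType.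
Implicit Types (p q : {poly K}) (z v : K).

Lemma horner_flip p v : (flip p).[v] = p.[- v].
Proof. by rewrite /flip horner_comp hornerN hornerX. Qed.

Lemma coef_subr_flip p j : (p - flip p)`_j = (1 - (-1) ^+ j) * p`_j.
Proof. by rewrite coefB coef_flip mulrBl mul1r. Qed.

(** [p - flip p] has no even coefficients, so the term after index 2m + 1 has index 2m + 3: a gain
    of two powers of v. *)
Lemma horner_odd_part m p v : oddvan m p ->
  (p - flip p).[v] = 2 * p`_(2 * m + 1) * v ^+ (2 * m + 1)
    + (drop_poly (2 * m + 3) (p - flip p)).[v] * v ^+ (2 * m + 1 + 2).
Proof.
move=> hp; rewrite -{1}[p - flip p](poly_take_drop (2 * m + 3)).
rewrite hornerD hornerM hornerXn -addnA; congr (_ + _).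
have -> : take_poly (2 * m + 3) (p - flip p) =
    (2 * p`_(2 * m + 1)) *: 'X^(2 * m + 1).
  apply/polyP => j; rewrite coef_take_poly coefZ coefXn coef_subr_flip -signr_odd.
  have [oj|ej] := boolP (odd j); last first.
    rewrite expr0 subrr mul0r if_same; case: eqP => [e|_]; last by rewrite mulr0.
    by move: ej; rewrite e; lia.
  have [->|jm] := eqVneq j (2 * m + 1)%N.
    by rewrite ltn_add2l /= expr1 opprK mulr1.
  rewrite mulr0; case: ltnP => // j3; rewrite hp ?mulr0 //; lia.
by rewrite hornerZ hornerXn.
Qed.

Lemma regular_coef z (P Q : K -> {poly K}) (c : nat -> K) n :
  regular_family z P -> (forall u j, (Q u)`_j = c j * (P u)`_(j + n)) ->
  regular_family z Q.
Proof.
move=> [[s sP] dP] hQ; split.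
  exists s => u; apply/leq_sizeP => j sj; rewrite hQ nth_default ?mulr0 //.
  by rewrite (leq_trans (sP u)) // (leq_trans sj) ?leq_addr.
move=> j; have -> : (fun u => (Q u)`_j) = (fun u => cst (c j) u * (P u)`_(j + n)).
  by apply/funext => u; rewrite hQ.
by apply: differentiableM => //; exact: (differentiable_cst (c j)).
Qed.

Lemma near0_norm_lt (e : K) : 0 < e -> \forall v \near (0 : K), `|v| < e.
Proof.
move=> e0; have := nbhsx_ballx (0 : K) e e0; apply: filterS => v.
by rewrite -ball_normE /= sub0r normrN.
Qed.

Lemma near_diag_pair z (Q : K * K -> Prop) : (\forall p \near (z, z), Q p) ->
  \forall v \near (0 : K), Q (z + v, z - v).
Proof.
move=> h; have c1 : (fun v => z + v) @ nbhs (0 : K) --> z.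
  apply/cvgrPdist_lt => e e0; near=> v.
  rewrite opprD addrA subrr add0r normrN.
  by near: v; exact: near0_norm_lt.
have c2 : (fun v => z - v) @ nbhs (0 : K) --> z.
  apply/cvgrPdist_lt => e e0; near=> v.
  by rewrite subKr; near: v; exact: near0_norm_lt.
exact: (cvg_pair c1 c2).
Unshelve. all: by end_near. Qed.

Lemma coef0_small p n (M : K) : 0 <= M ->
  (\forall v \near (0 : K), v != 0 -> `|p.[v]| <= M * `|v| ^+ n.+1) -> p`_0 = 0.
Proof.
move=> M0 h.
have c : horner p @ 0^' --> p`_0.
  rewrite -horner_coef0; apply: cvg_within_filter.
  exact: is_derive_continuous (is_derive_horner p 0).
have c0 : horner p @ 0^' --> (0 : K).
  apply/cvgrPdist_le => e e0.
  have M1 : 0 < M + 1 by rewrite ltr_wpDl.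
  have hb1 := near0_norm_lt ltr01.
  have hbe := near0_norm_lt (divr_gt0 e0 M1).
  apply: filterS (@filterI _ _ (nbhs_filter (0 : K)) _ _ h
     (@filterI _ _ (nbhs_filter (0 : K)) _ _ hb1 hbe)) => v [hv [v1 ve]] v0.
  rewrite sub0r normrN (le_trans (hv v0)) // exprSr mulrA.
  apply: (@le_trans _ _ (M * `|v|)).
    by rewrite ler_wpM2r // ler_piMr // exprn_ile1 // ltW.
  apply: ltW; apply: le_lt_trans (_ : (M + 1) * `|v| < e).
    by rewrite ler_wpM2r // lerDl.
  by rewrite mulrC -ltr_pdivlMr.
exact: (cvg_unique _ c c0).
Qed.

(** Continuity at 0 kills the constant term, and division by v then lowers the order by one. *)
Lemma coef_small p n (M : K) : 0 <= M ->
  (\forall v \near (0 : K), v != 0 -> `|p.[v]| <= M * `|v| ^+ n) ->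
  forall j, (j < n)%N -> p`_j = 0.
Proof.
move=> M0; elim: n p => [//|n IH] p h.
have p0 := coef0_small M0 h.
have pE : p = drop_poly 1 p * 'X.
  rewrite -[LHS](poly_take_drop 1) expr1 -[RHS]add0r; congr (_ + _).
  by apply/polyP => -[|i]; rewrite coef_take_poly coef0.
have hd : \forall v \near (0 : K), v != 0 -> `|(drop_poly 1 p).[v]| <= M * `|v| ^+ n.
  move: h; apply: filterS => v hv v0.
  have := hv v0; rewrite {1}pE hornerM hornerX normrM exprSr mulrA.
  by rewrite ler_pM2r ?normr_gt0.
move=> [//|j jn]; have := IH _ hd j jn.
by rewrite coef_drop_poly addn1.
Qed.

End OddPart.

Section Equivalence.
Variable R : realType.
Local Notation C := (CC R).
Variables (k : nat) (a b : 'I_k -> C) (U : set C) (f : C -> C) (m : nat).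
Hypotheses (oU : open U) (fbr : is_branch a b U f).
Variable F : {poly {poly C}}.
(** The remainder then has order N + 1 = 2m + 3, two more than the exponent of the denominator. *)
Let N := (2 * m).+2.
Let P u := taylor_cut a b F N u.
Let num (p : C * C) := f p.1 * F.[p.1, p.2] - f p.2 * F.[p.2, p.1].

Let num_bound z : U z -> exists2 M : C, 0 <= M & \forall p \near (z, z),
   `|num p - f (midpoint p) * (P (midpoint p) - flip (P (midpoint p))).[half_diff p]|
     <= M * `|half_diff p| ^+ (2 * m + 3).
Proof.
move=> Uz; have [M M0 hM] := num_taylor fbr F N Uz; exists M => //.
by move: hM; apply: filterS => p; rewrite hornerD hornerN horner_flip addn3.
Qed.

(** For fixed u, put x = u + v and y = u - v and let v tend to 0. Since h is bounded near (u, u),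
    f(u) (P(v) - P(-v)) is O(v^(2m+1)); its odd coefficients are 2 f(u) times those of P, and f(u)
    is nonzero. *)
Lemma quasi_to_qinv : quasi_invariant m U f F ->
  forall u, U u -> oddvan m (P u).
Proof.
move=> [h [dh hE]] u Uu.
have [M M0 hM] := num_bound Uu.
have [M1 M10 hM1] := locally_bounded (differentiable_continuous (dh (u, u) (conj Uu Uu))).
have hU : \forall x \near u, U x by apply: open_nbhs_nbhs.
pose c2 : C := 2 ^+ (2 * m + 1).
have c2n : c2 != 0 by rewrite expf_neq0 // pnatr_eq0.
have c20 : 0 <= c2 by rewrite exprn_ge0.
pose Q := f u *: (P u - flip (P u)).
have hQ : \forall v \near (0 : C), v != 0 ->
    `|Q.[v]| <= (M1 * c2 + M) * `|v| ^+ (2 * m + 1).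
  have n1 := near_diag_pair hM.
  have n2 := near_diag_pair hM1.
  have n3 := near_diag_pair (near_fst hU).
  have n4 := near_diag_pair (near_snd hU).
  have n5 := near0_norm_lt (@ltr01 C).
  have ff := nbhs_filter (0 : C).
  apply: filterS (@filterI _ _ ff _ _ (@filterI _ _ ff _ _ n1 n2)
    (@filterI _ _ ff _ _ n5 (@filterI _ _ ff _ _ n3 n4))).
  move=> v [[k1 k2] [k5 [k3 k4]]] v0.
  have midpointE : midpoint (u + v, u - v) = u by rewrite /midpoint /=; field.
  have half_diffE : half_diff (u + v, u - v) = v by rewrite /half_diff /=; field.
  have xyE : u + v - (u - v) = 2 * v by ring.
  have xy : u + v != u - v by rewrite -subr_eq0 xyE mulf_neq0 ?pnatr_eq0.
  rewrite midpointE half_diffE in k1.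
  have numE : num (u + v, u - v) = h (u + v, u - v) * (c2 * v ^+ (2 * m + 1)).
    have vn : c2 * v ^+ (2 * m + 1) != 0 by rewrite mulf_neq0 ?expf_neq0.
    by rewrite hE // xyE exprMn -/c2 divfK.
  rewrite hornerZ -[_ * _.[v]](subKr (num (u + v, u - v))).
  rewrite numE; rewrite (_ : 2 * m + 3 = 2 * m + 1 + 2)%N in k1; last by rewrite -addnA.
  rewrite numE in k1; exact: norm_subM_le (ltW k5) M0 c20 k2 k1.
have MM : 0 <= M1 * c2 + M by rewrite addr_ge0 // mulr_ge0.
move=> j oj jm; have := coef_small MM hQ (j := j); rewrite coefZ coef_subr_flip.
have jm1 : (j < 2 * m + 1)%N by rewrite addn1 ltnS ltnW.
rewrite -signr_odd oj opprK => /(_ jm1) /eqP.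
rewrite !mulf_eq0 (negbTE (branch_neq0 fbr Uu)) /=.
by rewrite (_ : 1 + _ = 2%:R) // pnatr_eq0 => /eqP.
Qed.

Lemma qinv_to_quasi : (forall u, U u -> oddvan m (P u)) ->
  quasi_invariant m U f F.
Proof.
move=> ho; pose c2 : C := 2 ^+ (2 * m + 1).
have c2n : c2 != 0 by rewrite expf_neq0 // pnatr_eq0.
(* The limit on the diagonal: the numerator starts with 2 f(u) P_(2m+1) v^(2m+1), and the
   denominator is (2v)^(2m+1) = c2 v^(2m+1). *)
pose kappa u := f u * (2 / c2 * (P u)`_(2 * m + 1)).
pose h p := if p.1 == p.2 then kappa p.1 else num p / (p.1 - p.2) ^+ (2 * m + 1).
exists h; split; last by move=> x y _ _ /negbTE xy; rewrite /h /= xy.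
move=> [x y] [/= Ux Uy].
have dfst := differentiable_fst; have dsnd := differentiable_snd.
have dB q : differentiable (fun q : C * C => q.1 - q.2) q.
  exact: (@differentiableB _ _ _ (@fst C C) (@snd C C)).
have [xy|xy] := eqVneq x y; last first.
  have nxy : \forall q \near (x, y), q.1 - q.2 != 0.
    have c : {for (x, y), continuous (fun q : C * C => q.1 - q.2)}.
      exact: differentiable_continuous (dB (x, y)).
    by apply: (cvgr_neq0 _ c); rewrite subr_eq0.
  pose g1 q : C := num q / (q.1 - q.2) ^+ (2 * m + 1).
  (* Off the diagonal h coincides locally with the plain quotient, so the error constant is 0. *)
  apply: (@differentiable_add_small _ _ _ h g1 (x, y) 0) => //; last first.
    move: nxy; apply: filterS => q; rewrite subr_eq0 /h => /negbTE ->.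
    by rewrite subrr normr0 mul0r.
  apply: differentiableM.
    apply: differentiableB; apply: differentiableM.
    - by apply: (@differentiable_comp _ _ _ _ (@fst C C) f); [exact: dfst|exact (branch_differentiable fbr Ux)].
    - exact: differentiable_horner2.
    - by apply: (@differentiable_comp _ _ _ _ (@snd C C) f); [exact: dsnd|exact (branch_differentiable fbr Uy)].
    - apply: (@differentiable_comp _ _ _ _ (fun q : C * C => (q.2, q.1))
        (fun q : C * C => F.[q.1, q.2])); last exact: differentiable_horner2.
      exact: (@differentiable_pair _ _ _ _ (@snd C C) (@fst C C)).
  apply: differentiableV; last by rewrite expf_neq0 // subr_eq0.
  exact: differentiable_expf.
rewrite -xy {y Uy xy}.
have dk : differentiable kappa x.
  have [_ dP] := regular_taylor_cut fbr F N Ux.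
  have dfx := branch_differentiable fbr Ux.
  apply: (@differentiableM _ _ f (fun u => 2 / c2 * (P u)`_(2 * m + 1))); first exact dfx.
  apply: (@differentiableM _ _ (cst (2 / c2)) (fun u => (P u)`_(2 * m + 1))).
    exact: (differentiable_cst (2 / c2)).
  exact: dP.
have dkm : differentiable (kappa \o @midpoint C) (x, x).
  apply: differentiable_comp; first exact: differentiable_midpoint.
  by rewrite midpoint_diag.
pose S u := drop_poly (2 * m + 3) (P u - flip (P u)).
have [M2 M20 hM2] : exists2 M, 0 <= M & \forall u \near x, forall v, `|v| <= 1 -> `|(S u).[v]| <= M.
  apply: regular_bounded.
  apply: (regular_coef (c := fun j => 1 - (-1) ^+ (j + (2 * m + 3))) (n := (2 * m + 3))
    (regular_taylor_cut fbr F N Ux)) => u j.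
  by rewrite coef_drop_poly coef_subr_flip.
have [M M0 hM] := num_bound Ux.
have [M3 M30 hM3] := locally_bounded (differentiable_continuous
  (branch_differentiable fbr Ux)).
have hU : \forall u \near x, U u by apply: open_nbhs_nbhs.
have MM : 0 <= M + M3 * M2 by rewrite addr_ge0 // mulr_ge0.
(* Near (x, x), h is compared with [kappa] at the midpoint, a differentiable function of the
   pair. *)
apply: (differentiable_add_small MM dkm).
have n2 := near_midpoint hM2; have n3 := near_midpoint hM3; have n4 := near_midpoint hU.
have n5 := near_diag_dist x.
have ff := nbhs_filter ((x, x) : C * C).
apply: filterS (@filterI _ _ ff _ _ (@filterI _ _ ff _ _ hM n2)
  (@filterI _ _ ff _ _ n3 (@filterI _ _ ff _ _ n4 n5))).
move=> q [[k1 k2] [k3 [k4 k5]]].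
have qE : q.1 - q.2 = 2 * half_diff q by rewrite /half_diff; field.
rewrite /h /=; have [q12|q12] := eqVneq q.1 q.2.
  have -> : midpoint q = q.1 by rewrite /midpoint -q12; field.
  by rewrite subrr normr0 mulr_ge0 ?exprn_ge0.
have v0 : half_diff q != 0.
  by apply: contra q12 => /eqP e; rewrite -subr_eq0 qE e mulr0.
have v1 : `|half_diff q| <= 1.
  have : `|2 * half_diff q| <= 1 by rewrite -qE distrC.
  exact: le_trans (normr_le_double _).
have PE := horner_odd_part (half_diff q) (ho _ k4).
rewrite qE exprMn.
rewrite (_ : 2 * m + 3 = 2 * m + 1 + 2)%N in k1; last by rewrite -addnA.
apply: (norm_quotient_le v0 PE k1 (k2 _ v1) k3); last exact: pair_dist_le.
by rewrite exprn_ege1 // ler1n.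
Qed.

End Equivalence.

Lemma open_poly_ext (K : numFieldType) (U : set K) (p : {poly K}) :
  open U -> U !=set0 -> (forall x, U x -> p.[x] = 0) -> p = 0.
Proof.
move=> oU [z Uz] pU; have : nbhs z U by exact: open_nbhs_nbhs.
move=> /nbhs_ballP[r r0 hr].
have r_neq0 : r != 0 by rewrite lt0r_neq0.
(* The denominators start at 2 to keep the points strictly inside the ball of radius r. *)
apply: (@poly_inj_roots _ _ (fun n => z + r / n.+2%:R)) => [i j /addrI|n].
  move=> /(mulfI r_neq0)/invr_inj/eqP; rewrite eqr_nat => /eqP [].
  exact.
apply/pU/hr; rewrite -ball_normE /= opprD addrA subrr add0r normrN.
rewrite ger0_norm ?divr_ge0 ?ltW // ltr_pdivrMr ?ltr0n //.
by rewrite ltr_pMr // ltr1n.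
Qed.

Lemma dtrunc_trunc_abs (R : realType) m (z : CC R) : trunc_abs m z (dtrunc m z).
Proof.
rewrite /dtrunc; case: eqP => [e|ne]; [left|right].
  by exists (Num.floor (complex.Re z)).
split=> // n e; apply: ne; rewrite e.
have -> : n%:~R = real_complex R n%:~R :> CC R by rewrite rmorph_int.
by rewrite /= intrKfloor rmorph_int.
Qed.

Theorem theorem3p13 (R : realType) (m k : nat) (a b : 'I_k -> CC R)
    (U : set (CC R)) (f : CC R -> CC R) :
  injective a ->
  open U -> connected U -> U !=set0 -> (forall i, ~ U (a i)) ->
  is_branch a b U f ->
  exists2 H : nat -> int,
    is_hilbert_series (quasi_invariant m U f) H
    & is_expansion H
        ('X^(2 * m) + 'X^(2 * m + 1)
         + \sum_(1 <= i < m.+1) 'X^(2 * (m - i) + dtruncf i b)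
         - \sum_(1 <= i < m.+1) 'X^(2 * (m - i) + dtruncf i b + 2))
        ((1 - 'X) * (1 - 'X^2)).
Proof.
move=> inja oU _ U0 _ fbr.
have infU (p : {poly CC R}) : (forall x, U x -> p.[x] = 0) -> p = 0.
  exact: open_poly_ext.
have Ua u i : U u -> u != a i by exact: (branch_avoids fbr).
have hD i j : trunc_abs i (b j) (dtrunc i (b j)) by exact: dtrunc_trunc_abs.
pose D i j := dtrunc i (b j).
have qd0 : forall i, qdim D i 0 = 0%N.
  by elim=> [//|i IH] /=; rewrite IH.
exists (fun n => (qdim D m n.+1)%:Z - (qdim D m n)%:Z); last first.
  exact: (hilbert_expansion (e := fun i => dtruncf i b)).
(* The shift passes from degree below d + 1 to degree at most d; [qdim D m 0 = 0] matches the
   convention that the space of degree at most -1 is zero. *)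
exists (fun d => qdim D m d.+1); split=> [d|[|d]]; last by [].
  have mN : (2 * m <= (2 * m).+2)%N by rewrite ltnW.
  have [e [efree eS]] := has_basis_of_uv (fun F => iff_refl _)
    (has_basis_qinv infU inja Ua hD d.+1 mN).
  exists e; split => //; apply/seteqP.
  have qE F : (quasi_invariant m U f `&` total_degree_le d) F <->
      exists c : 'I_(qdim D m d.+1) -> CC R, F = \sum_i (c i)%:P *: e i.
    rewrite -eS tdeg_lt_to_uv; split=> -[h1 h2]; split=> //.
      exact: (quasi_to_qinv oU fbr).
    exact: (qinv_to_quasi oU fbr).
  by split=> F /qE.
by rewrite qd0.
Qed.
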